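(* Let $d\ge 1$, $M\in\mathbb{N}$ with $M\ge 2$, $p\in(0,1]$, and let $F$ be a fractal percolation on $[0,1]^d$ with parameters $M$ and $p$, with construction steps $F_n$. Then, for each $n\in\mathbb{N}$, $$\mathbb{E}V_{d-1}(F_n)=\bar c_1\cdot(Mp)^n\left(1+\frac{M-1}{1-p}\left(\frac pM\right)^{n+1}\right),$$ where $\bar c_1:=\frac{dM(1-p)}{M-p}=\overline{\mathcal V}_{d-1}(F)$ (for $p=1$, the product $\bar c_1\cdot\frac{M-1}{1-p}$ is understood as $\frac{dM(M-1)}{M-p}$). Moreover, if $p>M^{-d}$, then, as $n\to\infty$, $$\mathrm{Var}(V_{d-1}(F_n))=\bar c_2\cdot(Mp)^{2n}+\begin{cases}O\big((Mp^3)^n\big), & \text{if } p^2>1/M^{d-1},\\ O\big((Mp^3)^n\cdot n\big), & \text{if } p^2=1/M^{d-1},\\ O\big((p/M^{d-2})^n\big), & \text{if } p^2<1/M^{d-1},\end{cases}$$ where $\bar c_2:=\bar c_1^2\cdot\frac{1-p}{M^dp-1}=(\overline{\mathcal V}_{d-1}(F))^2\,\mathrm{Var}(W_\infty)$.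
   Context: Fractal percolation: Let $J=[0,1]^d$, $\Sigma=\{1,\ldots,M^d\}$, let $J_1,\ldots,J_{M^d}$ be the $M^d$ closed subcubes of side length $1/M$ into which $J$ is divided, and let $\varphi_j$ be the homothetic (rotation- and reflection-free) similarity mapping $J$ onto $J_j$. For $\sigma=\sigma_1\ldots\sigma_n\in\Sigma^n$ let $J_\sigma=\varphi_{\sigma_1}\circ\cdots\circ\varphi_{\sigma_n}(J)$, and for $m\le n$ let $\sigma|m=\sigma_1\ldots\sigma_m$. Let $\{Y_\sigma:\sigma\in\bigcup_{n\ge1}\Sigma^n\}$ be i.i.d. Bernoulli variables with parameter $p$. Put $F_0=J$ and, for $n\ge1$, let $F_n$ be the union of all $J_\sigma$, $\sigma\in\Sigma^n$, with $Y_{\sigma|1}=\cdots=Y_{\sigma|n}=1$ (the retained cubes of level $n$). The fractal percolation is $F=\bigcap_n F_n$. $D:=\log(M^dp)/\log M$. $V_{d-1}$ is the intrinsic volume of order $d-1$ (half the surface area), extended additively to finite unions of compact convex sets, with $V_{d-1}(\emptyset)=0$. $\overline{\mathcal V}_{d-1}(F):=\lim_{n\to\infty}M^{n(d-1-D)}\mathbb{E}V_{d-1}(F_n)$, a limit known to exist. $N_n$ is the number of retained cubes of level $n$; it is a Galton–Watson process with $\mathrm{Bin}(M^d,p)$ offspring distribution, $\mathbb{E}N_n=(M^dp)^n$, and $W_\infty$ is the almost sure limit of the martingale $W_n:=N_n/\mathbb{E}N_n$. The constants in the $O$-terms may depend on $d,M,p$. *)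

(* Defs.v *)
From HB Require Import structures.
From mathcomp Require Import all_boot all_order all_algebra.
From mathcomp Require Import all_classical all_reals all_analysis.

Set Implicit Arguments.
Unset Strict Implicit.
Unset Printing Implicit Defensive.

Import Order.TTheory GRing.Theory Num.Theory.
Import numFieldNormedType.Exports.

Local Open Scope classical_set_scope.
Local Open Scope ring_scope.

Section intrinsic_volumes.
Context {R : realType}.

(* Lebesgue measure of R^n on Borel sets, as the n-fold product of the
   one-dimensional Lebesgue measure: the successor case is the formula by which
   the library defines the product measure [mu1 \x mu2], with 'rV_n.+1 seen as
   R * 'rV_n. *)
Fixpoint volume (n : nat) : set 'rV[R]_n -> \bar R :=
  match n with
  | 0 => fun A => (\1_A (0 : 'rV[R]_0))%:E
  | m.+1 => fun A =>
      (\int[@lebesgue_measure R]_x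
         volume [set y : 'rV[R]_m | A (row_mx (x%:M : 'rV[R]_1) y)])%E
  end.

(* The canonical norm of 'rV[R]_n is the sup norm, hence this one. *)
Definition enorm n (x : 'rV[R]_n) : R := Num.sqrt (\sum_i x 0 i ^+ 2).

Definition unit_ball_volume (n : nat) : R :=
  fine (volume [set x : 'rV[R]_n | enorm x <= 1]).

Definition parallel_body n (K : set 'rV[R]_n) (e : R) : set 'rV[R]_n :=
  [set x | exists2 y, K y & enorm (x - y) <= e].

Definition convex_body n (K : set 'rV[R]_n) : Prop := compact K /\ convex_set K.

Definition polyconvex n (A : set 'rV[R]_n) : Prop :=
  exists (m : nat) (K : 'I_m -> set 'rV[R]_n),
    (forall i, convex_body (K i)) /\ A = \bigcup_i K i.

(* [V j] is the intrinsic volume of order j on convex bodies, by the Steiner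
   formula, together with its additive extension to finite unions of convex
   bodies. These clauses determine [V j A] for j <= d and A polyconvex. *)
Definition intrinsic_volumes d (V : nat -> set 'rV[R]_d -> R) : Prop :=
  [/\ forall (K : set 'rV[R]_d) (e : R), convex_body K -> K !=set0 -> 0 <= e ->
        volume (parallel_body K e) =
        (\sum_(j < d.+1) unit_ball_volume (d - j) * e ^+ (d - j) * V j K)%:E,
      forall j, (j <= d)%N -> V j set0 = 0
    & forall j (A B : set 'rV[R]_d), (j <= d)%N -> polyconvex A -> polyconvex B ->
        V j (A `|` B) = V j A + V j B - V j (A `&` B)].

End intrinsic_volumes.

(* Independence of a family: every finite subfamily satisfies the product rule. *)
Definition mutually_independent (R : realType) (dO dS : measure_display)
    (Omega : measurableType dO) (S : measurableType dS) (P : probability Omega R)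
    (I : choiceType) (D : set I) (X : I -> Omega -> S) : Prop :=
  forall (s : seq I) (B : I -> set S), uniq s ->
    (forall i, i \in s -> D i /\ measurable (B i)) ->
    P (\bigcap_(i in [set` s]) X i @^-1` B i) =
    (\prod_(i <- s) fine (P (X i @^-1` B i)))%:E.

(* The M^d letters: the subcube of side 1/M whose corner closest to the origin
   is a / M is named by the vector a rather than by its rank in an enumeration. *)
Definition letter (d M : nat) := {ffun 'I_d -> 'I_M}.

Section cubes.
Context {R : realType} {d M : nat}.

Definition unit_cube : set 'rV[R]_d := [set x | forall i, 0 <= x 0 i <= 1].

Definition phi (a : letter d M) (x : 'rV[R]_d) : 'rV[R]_d :=
  M%:R^-1 *: (x + \row_i (a i)%:R).

Definition cube (s : seq (letter d M)) : set 'rV[R]_d :=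
  foldr (fun a f => phi a \o f) id s @` unit_cube.

End cubes.

Record fractal_percolation (R : realType) (d M : nat) (p : R) := {
  display : measure_display ;
  Omega : measurableType display ;
  Pr : probability Omega R ;
  (* the value of [Y] at the empty word is never used *)
  Y : seq (letter d M) -> {RV Pr >-> bool} ;
  Y_bernoulli : forall s, s != [::] ->
    distribution Pr (Y s) = bernoulli_prob p :> (set bool -> \bar R) ;
  Y_independent : mutually_independent Pr [set s | s != [::]] (fun s => Y s)
}.

Section percolation.
Context {R : realType} {d M : nat} {p : R}.
Variable F : fractal_percolation d M p.

Definition retained (s : seq (letter d M)) (w : Omega F) : bool :=
  all (fun m => Y F (take m s) w) (iota 1 (size s)).

Definition step (n : nat) (w : Omega F) : set 'rV[R]_d :=
  \bigcup_(s in [set s : n.-tuple (letter d M) | retained s w]) cube s.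

Definition Ncubes (n : nat) (w : Omega F) : R :=
  #|[pred s : n.-tuple (letter d M) | retained s w]|%:R.

Definition Wn (n : nat) (w : Omega F) : R :=
  Ncubes n w / fine ('E_(Pr F)[Ncubes n])%E.

Definition is_Winfty (W : {RV (Pr F) >-> R}) : Prop :=
  {ae Pr F, forall w, Wn n w @[n --> \oo] --> W w}.

Definition Ddim : R := ln (M%:R ^+ d * p) / ln M%:R.

Variable V : set 'rV[R]_d -> R.

Definition rescaled_mean (n : nat) : R :=
  M%:R `^ (n%:R * (d%:R - 1 - Ddim)) * fine ('E_(Pr F)[V \o step n])%E.

Definition Vbar : R := lim (rescaled_mean n @[n --> \oo]).

End percolation.

Arguments retained {R d M p} F s w.
Arguments step {R d M p} F n w.
Arguments Ncubes {R d M p} F n w.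
Arguments Wn {R d M p} F n w.
Arguments is_Winfty {R d M p} F W.
Arguments rescaled_mean {R d M p} F V n.
Arguments Vbar {R d M p} F V.

Definition variance_rate (R : realType) (d M : nat) (p : R) (n : nat) : R :=
  if p ^+ 2 > 1 / M%:R ^+ d.-1 then (M%:R * p ^+ 3) ^+ n
  else if p ^+ 2 == 1 / M%:R ^+ d.-1 then (M%:R * p ^+ 3) ^+ n * n%:R
  else (p / M%:R ^ (d%:Z - 2)) ^+ n.

(* Main.v *)
(** By the Steiner formula the intrinsic volume of order d-1 of a box with sides
    a_i is the sum over i of the products of the a_j, j <> i: for small e, the
    parallel body lies between the union of the d boxes lengthened by e at both
    ends of one side and the box with all sides lengthened so.  Three distinct
    cubes of a grid meet in dimension at most d-2, hence, with X_s the indicator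
    of the event that the word s is retained, M^(n(d-1)) V_(d-1)(F_n) is
    d * (sum over s of X_s) minus the sum of X_s X_t over adjacent s, t.  A
    product of X's has mean p^k, k the number of prefixes of the words involved,
    so splitting words by their first letter gives recursions in n for the first
    two moments.  In the second one, the terms that come from adjacent words with
    distinct first letters are of relative size (p/M)^n, and the remaining
    recursion contracts by the factor 1/(M^d p).
    The same recursion gives E(W_m - W_n)^2, so Fatou's lemma yields convergence
    of W_n in L^2 and Var(W_oo) = (1-p)/(M^d p - 1). *)

Require Import Defs.
From HB Require Import structures.
From mathcomp Require Import all_boot all_order all_algebra.
From mathcomp Require Import all_classical all_reals all_analysis measurable_realfun.
From mathcomp Require Import ring lra zify.
Set Implicit Arguments.
Unset Strict Implicit.
Unset Printing Implicit Defensive.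
Import Order.TTheory GRing.Theory Num.Theory.
Import numFieldNormedType.Exports.
Local Open Scope classical_set_scope.
Local Open Scope ring_scope.

(** * Volumes of boxes *)

(** [volume] is an iterated integral, applied here to sets such as parallel bodies that are never
    shown to be measurable. What makes this work is that the integral of nonnegative functions is
    monotone without measurability, so only step functions have to be integrated exactly. The
    moments need no conditional expectations: every variable of the percolation that occurs is a
    finite combination of indicators of events that a list of words is retained, and products
    concatenate the lists. Splitting at the first letter is natural because deleting a common first
    letter keeps adjacency and removes exactly one prefix, while words with distinct first letters
    share no prefix and are independent. With q = M^d p, the rescaled variance divided by q^(2n)
    obeys a contraction of factor 1/q perturbed by terms of order (p/M)^n. Which of 1/q and p/M
    dominates is the comparison of p^2 with 1/M^(d-1), whence the three cases of the error term. *)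

Section volume.
Context {R : realType}.
Local Notation mu := (@lebesgue_measure R).

(** The integral of a nonnegative function is a supremum over the simple functions below it, and a
    simple function below f is below g. *)
Lemma ge0_le_integral_nomeas (f g : R -> \bar R) :
  (forall x, 0 <= f x)%E -> (forall x, f x <= g x)%E ->
  (\int[mu]_x f x <= \int[mu]_x g x)%E.
Proof.
move=> f0 fg; have g0 x : (0 <= g x)%E by exact: le_trans (f0 x) (fg x).
rewrite !ge0_integralTE//; apply: le_ereal_sup => _ [h hf <-].
by exists h => // x; exact: le_trans (hf x) (fg x).
Qed.

Lemma volume_ge0 n (A : set 'rV[R]_n) : (0 <= volume A)%E.
Proof.
by elim: n A => [|n IH] A /=; [rewrite lee_fin | apply: integral_ge0 => x _].
Qed.

Lemma le_volume n (A B : set 'rV[R]_n) : A `<=` B -> (volume A <= volume B)%E.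
Proof.
elim: n A B => [|n IH] A B AB /=.
  rewrite lee_fin !indicE ler_nat.
  by case: (boolP (0 \in A)) => //; rewrite inE => /AB/mem_set ->.
apply: ge0_le_integral_nomeas => x; first exact: volume_ge0.
by apply: IH => y; exact: AB.
Qed.

Lemma volume_set0 n : volume (set0 : set 'rV[R]_n) = 0%E.
Proof.
elim: n => [|n IH] /=; first by rewrite indic0.
by apply: integral0_eq => x _; exact: IH.
Qed.

Definition box {n} (l u : 'I_n -> R) : set 'rV[R]_n :=
  [set x | forall i, l i <= x 0 i <= u i].

Lemma row_mx_lift0 n (x : R) (y : 'rV[R]_n) :
  ((row_mx (x%:M : 'rV[R]_1) y : 'rV[R]_n.+1) 0 ord0 = x) *
  (forall i, (row_mx (x%:M : 'rV[R]_1) y : 'rV[R]_n.+1) 0 (lift ord0 i) = y 0 i).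
Proof.
split.
  have -> : (ord0 : 'I_n.+1) = lshift n (ord0 : 'I_1) by exact/val_inj.
  by rewrite (row_mxEl (x%:M : 'rV[R]_1)) mxE eqxx.
move=> i; have -> : lift ord0 i = rshift 1 i by exact/val_inj.
by rewrite (row_mxEr (x%:M : 'rV[R]_1)).
Qed.

Lemma box_row_mx n (l u : 'I_n.+1 -> R) (x : R) (y : 'rV[R]_n) :
  box l u (row_mx (x%:M : 'rV[R]_1) y) <->
  l ord0 <= x <= u ord0 /\ box (l \o lift ord0) (u \o lift ord0) y.
Proof.
split=> [h|[h0 h] i].
  split; first by have := h ord0; rewrite row_mx_lift0.
  by move=> i /=; have := h (lift ord0 i); rewrite row_mx_lift0.
case: (unliftP ord0 i) => [j|] ->; rewrite row_mx_lift0 //; exact: h.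
Qed.

Lemma box_slice n (l u : 'I_n.+1 -> R) (x : R) :
  [set y : 'rV[R]_n | box l u (row_mx (x%:M : 'rV[R]_1) y)] =
  if l ord0 <= x <= u ord0 then box (l \o lift ord0) (u \o lift ord0) else set0.
Proof.
apply/seteqP; split=> y /=; first by move/box_row_mx => [-> h].
by case: ifP => // h0 h; apply/box_row_mx.
Qed.

Lemma integral_cst_itv (a b r : R) : a <= b -> 0 <= r ->
  (\int[mu]_x (if (a <= x <= b)%R then r%:E else 0) = ((b - a) * r)%:E)%E.
Proof.
move=> ab r0; transitivity (\int[mu]_x (r%:E * (\1_`[a, b] x)%:E))%E; last first.
  rewrite integralZl//; last exact: integrable_indic_itv.
  rewrite integral_indic//= setIT lebesgue_measure_itv /= lte_fin.
  case: ltP => ba; first by rewrite -EFinB -EFinM mulrC.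
  by have -> : b = a; [apply/le_anti/andP | rewrite subrr mul0r mule0].
apply: eq_integral => x _; rewrite indicE mem_setE in_itv /=.
by case: ifP => _; rewrite ?mule1 ?mule0.
Qed.

Lemma measurable_cst_itv (a b r : R) :
  measurable_fun [set: R] ((fun x => if a <= x <= b then r%:E else 0%:E) : R -> \bar R).
Proof.
by apply: measurable_fun_if => //; apply: measurable_and; exact: measurable_fun_ler.
Qed.

Lemma volume_box n (l u : 'I_n -> R) : (forall i, l i <= u i) ->
  volume (box l u) = (\prod_i (u i - l i))%:E.
Proof.
elim: n l u => [|n IH] l u lu /=.
  by rewrite big_ord0 indicE mem_set// => -[].
rewrite big_ord_recl -integral_cst_itv ?lu//.
  apply: eq_integral => x _; rewrite box_slice; case: ifP => _.
    by rewrite IH // => i; exact: lu.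
  exact: volume_set0.
by apply: prodr_ge0 => i _; rewrite subr_ge0.
Qed.

(** Products over j != i rather than quotients by [a i], because the intersection of two
    neighbouring cubes is a box with a zero side. *)
Definition facet_sum {n} (a : 'I_n -> R) : R := \sum_i \prod_(j | j != i) a j.

Lemma facet_sumS n (a : 'I_n.+1 -> R) :
  facet_sum a = \prod_i a (lift ord0 i) + a ord0 * facet_sum (a \o lift ord0).
Proof.
rewrite /facet_sum big_ord_recl; congr (_ + _).
  by rewrite big_mkcond big_ord_recl /= mul1r; apply: eq_bigr.
rewrite big_distrr; apply: eq_bigr => i _.
rewrite big_mkcond big_ord_recl /= [in RHS]big_mkcond /=; congr (_ * _).
Qed.

(* Contained in the parallel body, with the same volume up to terms of order e^2. *)
Definition cross {n} (l u : 'I_n -> R) (e : R) : set 'rV[R]_n :=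
  box l u `|` \bigcup_(i in [set: 'I_n])
    box (fun j => l j - (j == i)%:R * e) (fun j => u j + (j == i)%:R * e).

(** Slicing along the first coordinate: over the original interval a slice contains a
    lower-dimensional cross, over the two added intervals of length e it contains a box. *)
Lemma volume_cross n (l u : 'I_n -> R) e : 0 <= e -> (forall i, l i <= u i) ->
  ((\prod_i (u i - l i) + 2 * e * facet_sum (fun i => u i - l i))%:E <=
   volume (cross l u e))%E.
Proof.
move=> e0; elim: n l u => [|n IH] l u lu.
  rewrite /facet_sum !big_ord0 mulr0 addr0 /= lee_fin indicE mem_set//.
  by left => -[].
rewrite big_ord_recl facet_sumS /=.
set B := \prod_(i < n) _; set S := facet_sum _.
have B0 : 0 <= B by apply: prodr_ge0 => i _; rewrite subr_ge0.
have S0 : 0 <= S.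
  by apply: sumr_ge0 => i _; apply: prodr_ge0 => j _; rewrite subr_ge0.
set a := u ord0 - l ord0.
(* This form is the integral of a sum of two step functions: B on the lengthened interval and 2 e S
   on the original one. *)
have -> : a * B + 2 * e * (B + a * S) =
  (u ord0 + e - (l ord0 - e)) * B + a * (2 * e * S) by rewrite /a; ring.
rewrite EFinD -integral_cst_itv //; last by move: (lu ord0); lra.
rewrite -integral_cst_itv ?lu ?mulr_ge0//.
rewrite -ge0_integralD //=; last 4 first.
- by move=> x _; case: ifP; rewrite ?lee_fin.
- exact: measurable_cst_itv.
- by move=> x _; case: ifP; rewrite ?lee_fin ?mulr_ge0.
- exact: measurable_cst_itv.
apply: ge0_le_integral_nomeas => x.
  by case: ifP; case: ifP; rewrite /= ?add0e ?adde0 -?EFinD ?lee_fin ?addr_ge0 ?mulr_ge0.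
have [xin|xout] := boolP (l ord0 <= x <= u ord0).
  have -> : l ord0 - e <= x <= u ord0 + e by lra.
  rewrite -EFinD; apply: le_trans (IH (l \o lift ord0) (u \o lift ord0) _) _.
    by move=> i; exact: lu.
  apply: le_volume => y [yb|[i _ yi]]; first by left; apply/box_row_mx.
  right; exists (lift ord0 i) => //; apply/box_row_mx; split.
    by rewrite /= mul0r subr0 addr0.
  by move=> j /=; rewrite (inj_eq lift_inj); exact: yi.
rewrite adde0; case: ifP => xe; last exact: volume_ge0.
rewrite -volume_box; last by move=> i; exact: lu.
apply: le_volume => y yb; right; exists ord0 => //.
apply/box_row_mx; split; first by rewrite mul1r.
by move=> j; rewrite /= mul0r subr0 addr0; exact: yb.
Qed.

Lemma prod_enlarged_le n (a : 'I_n -> R) : (forall i, 0 <= a i) ->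
  exists C, 0 <= C /\ forall e, 0 <= e <= 1 ->
  \prod_i (a i + 2 * e) <= \prod_i a i + 2 * e * facet_sum a + C * e ^+ 2.
Proof.
elim: n a => [|n IH] a a0.
  exists 0; split=> // e _; rewrite /facet_sum !big_ord0; lra.
have [|C [C0 HC]] := IH (a \o lift ord0); first by move=> i; exact: a0.
set S := facet_sum (a \o lift ord0).
have S0 : 0 <= S by apply: sumr_ge0 => i _; apply: prodr_ge0 => j _; exact: a0.
(* The coefficient of e^2 in the expanded product is [a ord0 * C + 4 * S]; the term 2 C e^3 is
   absorbed using e <= 1. *)
exists (a ord0 * C + 4 * S + 2 * C); split.
  by have := a0 ord0 => ?; rewrite !addr_ge0 ?mulr_ge0.
move=> e e01; rewrite !big_ord_recl facet_sumS -/S.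
have /= H := HC _ e01; rewrite -/S in H.
have h : 0 <= a ord0 + 2 * e by have := a0 ord0; lra.
apply: le_trans (ler_wpM2l h H) _.
set P := \prod_(i < n) a (lift ord0 i).
have e3 : C * e ^+ 3 <= C * e ^+ 2.
  by rewrite ler_wpM2l // exprS ler_piMl ?sqr_ge0//; lra.
rewrite -subr_ge0 [X in 0 <= X](_ : _ = 2 * (C * e ^+ 2 - C * e ^+ 3)); last by ring.
by rewrite mulr_ge0 // subr_ge0.
Qed.

End volume.

(** * The Steiner formula for boxes *)

Section box_intrinsic_volume.
Context {R : realType}.

Lemma box_convex_body n (l u : 'I_n -> R) : convex_body (box l u).
Proof.
split.
  rewrite (_ : box l u = [set v : 'rV[R]_n | forall i, `[l i, u i]%classic (v ord0 i)]).
    by apply: (@rV_compact R n (fun i => `[l i, u i]%classic)) => i; exact: segment_compact.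
  by apply/seteqP; split=> x /= h i; have := h i; rewrite /= in_itv.
move=> x y t; rewrite !inE => hx hy i.
have h0 : 0 <= t%:num by [].
have h1 : t%:num <= 1 by [].
rewrite /conv /= !mxE /unstable.onem.
move: (x 0 i) (y 0 i) (hx i) (hy i) => xi yi /andP[lx xu] /andP[ly yu].
move: (t%:num) h0 h1 => {}t h0 h1.
have h2 : 0 <= 1 - t by rewrite subr_ge0.
have p1 : 0 <= t * (xi - l i) by rewrite mulr_ge0 ?subr_ge0.
have p2 : 0 <= t * (u i - xi) by rewrite mulr_ge0 ?subr_ge0.
have p3 : 0 <= (1 - t) * (yi - l i) by rewrite mulr_ge0 ?subr_ge0.
have p4 : 0 <= (1 - t) * (u i - yi) by rewrite mulr_ge0 ?subr_ge0.
by apply/andP; split; lra.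
Qed.

Lemma enorm_ge n (x : 'rV[R]_n) i : `|x 0 i| <= enorm x.
Proof.
rewrite -sqrtr_sqr ler_wsqrtr // (bigD1 i) //= lerDl.
by apply: sumr_ge0 => j _; exact: sqr_ge0.
Qed.

Lemma enorm_delta n (x : 'rV[R]_n) i :
  (forall j, j != i -> x 0 j = 0) -> enorm x = `|x 0 i|.
Proof.
move=> x0; rewrite -sqrtr_sqr /enorm (bigD1 i) //= big1 ?addr0 // => j ji.
by rewrite x0 // expr0n.
Qed.

Lemma parallel_box_sub n (l u : 'I_n -> R) (e : R) :
  parallel_body (box l u) e `<=` box (fun i => l i - e) (fun i => u i + e).
Proof.
move=> x [y yb xye] i; have := le_trans (enorm_ge (x - y) i) xye.
by rewrite !mxE ler_norml; have := yb i; lra.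
Qed.

Lemma cross_parallel_sub n (l u : 'I_n -> R) (e : R) : 0 <= e -> (forall i, l i <= u i) ->
  cross l u e `<=` parallel_body (box l u) e.
Proof.
move=> e0 lu x [xb|[i _ xi]].
  exists x => //; rewrite subrr /enorm big1 ?sqrtr0 // => i _.
  by rewrite mxE expr0n.
(* The i-th coordinate of x clamped to the side of the box; the other coordinates of x already lie
   in their sides. *)
pose c := Num.max (l i) (Num.min (u i) (x 0 i)).
have hc : l i <= c <= u i /\ `|x 0 i - c| <= e.
  have := xi i; have := lu i; rewrite eqxx mul1r /c ler_norml.
  move=> lui /andP[? ?]; case: (leP (u i) (x 0 i)) => ? /=.
    by rewrite (max_r lui); split; lra.
  by case: (leP (l i) (x 0 i)) => ? /=; split; lra.
exists (\row_j if j == i then c else x 0 j).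
  move=> j; rewrite mxE; case: eqP => [->|/eqP/negPf ji]; first exact: hc.1.
  by have := xi j; rewrite ji mul0r subr0 addr0.
rewrite (@enorm_delta _ _ i) ?mxE ?eqxx; first exact: hc.2.
by move=> j /negPf ji; rewrite !mxE ji subrr.
Qed.

Lemma unit_ball_volume0 : unit_ball_volume 0 = 1 :> R.
Proof.
rewrite /unit_ball_volume /= indicE mem_set //=.
by rewrite /enorm big_ord0 sqrtr0.
Qed.

Lemma unit_ball_volume1 : unit_ball_volume 1 = 2 :> R.
Proof.
rewrite /unit_ball_volume.
rewrite (_ : [set x | _] = box (fun=> -1) (fun=> 1)); last first.
  apply/seteqP; split=> x /=.
    move=> h i; have := le_trans (enorm_ge x i) h; by rewrite ler_norml.
  move=> h; rewrite (@enorm_delta _ _ ord0) ?ler_norml //.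
  by move=> j; rewrite (ord1 j).
by rewrite volume_box /= ?big_ord1 /=; [ring | move=> _; lra].
Qed.

Lemma eq_of_le_linear (v s c : R) :
  (forall e, 0 < e <= 1 -> `|v - s| <= c * e) -> v = s.
Proof.
move=> h; apply/eqP; rewrite -subr_eq0; apply/negPn/negP => vs.
have d0 : 0 < `|v - s| by rewrite normr_gt0.
have h1 := h 1 _; have c0 : 0 < c by have := h1 _; rewrite ltr01 lexx mulr1; lra.
have hm : `|v - s| / (2 * c) <= 1 by rewrite ler_pdivrMr ?mulr_gt0 //; have := h1 _; rewrite ltr01 lexx; lra.
(* At this e the hypothesis bounds the distance by half of itself. *)
have := h (`|v - s| / (2 * c)); rewrite hm divr_gt0 ?mulr_gt0 // => /(_ isT).
have -> : c * (`|v - s| / (2 * c)) = `|v - s| / 2 by field; lra.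
lra.
Qed.

Lemma intrinsic_volume_box d (V : nat -> set 'rV[R]_d -> R) (l u : 'I_d -> R) :
  intrinsic_volumes V -> (0 < d)%N -> (forall i, l i <= u i) ->
  V d.-1 (box l u) = facet_sum (fun i => u i - l i).
Proof.
move=> [steiner _ _]; case: d V l u steiner => // k V l u steiner _ lu /=.
have lu0 i : 0 <= u i - l i by rewrite subr_ge0.
have [C [C0 HC]] := prod_enlarged_le lu0.
set P := \prod_i (u i - l i) in HC; set S := facet_sum _ in HC *.
(* Bounds the Steiner terms with j < k, whose power of e is at least 2. *)
pose D := \sum_(j < k) `|unit_ball_volume (k.+1 - j) * V j (box l u)|.
have key e : 0 <= e <= 1 -> exists2 t : R, `|t| <= D * e ^+ 2 &
    P + 2 * e * S <= V k.+1 (box l u) + 2 * e * V k (box l u) + t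
      <= P + 2 * e * S + C * e ^+ 2.
  move=> e01; have e0 : 0 <= e by lra.
  exists (\sum_(j < k) unit_ball_volume (k.+1 - j) * e ^+ (k.+1 - j) * V j (box l u)).
    rewrite mulr_suml; apply: le_trans (ler_norm_sum _ _ _) _.
    apply: ler_sum => j _; rewrite mulrAC normrM ler_wpM2l //.
    by rewrite ger0_norm ?exprn_ge0 // ler_wiXn2l //; [lra | have := ltn_ord j; lia].
  set t := \sum_(j < k) _.
  have E : volume (parallel_body (box l u) e) =
    (V k.+1 (box l u) + 2 * e * V k (box l u) + t)%:E.
    rewrite steiner //; [congr EFin|exact: box_convex_body|]; last first.
      by exists (\row_i l i) => i; rewrite mxE lexx lu.
    rewrite 2!big_ord_recr /= subnn subSnn unit_ball_volume0 unit_ball_volume1.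
    by rewrite /t; ring.
  rewrite -!lee_fin -E; apply/andP; split.
    apply: le_trans (volume_cross e0 lu) _.
    by apply: le_volume; exact: cross_parallel_sub.
  apply: le_trans (le_volume (@parallel_box_sub _ l u e)) _.
  rewrite volume_box; last by move=> i; have := lu i; lra.
  rewrite lee_fin; apply: le_trans (HC _ e01).
  by apply: ler_prod => i _; have := lu i; lra.
(* At e = 0 the two bounds coincide and determine the top coefficient; it then cancels, and dividing
   by 2 e isolates the next one. *)
have VP : V k.+1 (box l u) = P.
  have [|t] := key 0; first by rewrite lexx ler01.
  rewrite expr0n /= !mulr0 normr_le0 => /eqP ->; lra.
apply: (@eq_of_le_linear _ _ ((C + D) / 2)) => e e01.
have [|t] := key e; first by lra.
rewrite VP !ler_norml => /andP[t1 t2] /andP[h1 h2].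
have e0 : 0 < e by lra.
have : - (C + D) * e * e <= 2 * e * (V k (box l u) - S) <= (C + D) * e * e.
  by move: t1 t2 h1 h2; rewrite !expr2; nra.
rewrite ![2 * e * _]mulrAC -![_ * e * e]mulrA.
by move=> /andP[]; rewrite -!mulrA ![e * _]mulrC !mulrA !ler_pM2r //; lra.
Qed.

End box_intrinsic_volume.

(** * Inclusion-exclusion for cubes of a grid *)

Lemma polyconvex_big (R : realType) d (I : eqType) (r : seq I) (K : I -> set 'rV[R]_d) :
  {in r, forall x, convex_body (K x)} -> polyconvex (\big[setU/set0]_(x <- r) K x).
Proof.
move=> cK; exists (size r), (fun i => K (tnth (in_tuple r) i)).
split=> [i|]; first exact/cK/mem_tnth.
rewrite (big_tnth _ _ r) -bigcup_seq.
by apply/seteqP; split=> x [i _ Ki]; exists i => //=; rewrite mem_index_enum.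
Qed.

Section inclusion_exclusion.
Context {R : realType} {d : nat}.
Variable W : set 'rV[R]_d -> R.
Hypothesis W0 : W set0 = 0.
Hypothesis WU : forall A B, polyconvex A -> polyconvex B ->
  W (A `|` B) = W A + W B - W (A `&` B).
Variable null : set 'rV[R]_d -> Prop.
Hypothesis W_null : forall A, null A -> W A = 0.
Hypothesis null_body : forall A, null A -> convex_body A.
Hypothesis nullI : forall A B, null A -> null B -> null (A `&` B).

Lemma W_big_cons (I : eqType) (K : I -> set 'rV[R]_d) x r :
  {in x :: r, forall y, convex_body (K y)} ->
  W (\big[setU/set0]_(y <- x :: r) K y) =
  W (K x) + W (\big[setU/set0]_(y <- r) K y) - W (\big[setU/set0]_(y <- r) (K x `&` K y)).
Proof.
move=> cK; rewrite big_cons WU; first by rewrite big_distrr.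
  have := @polyconvex_big R d I [:: x] K; rewrite big_seq1; apply=> y.
  by rewrite inE => /eqP ->; apply: cK; rewrite mem_head.
by apply: polyconvex_big => y yr; apply: cK; rewrite inE yr orbT.
Qed.

(** The intersections with the first body form a shorter list of null bodies, but of another family:
    hence the induction over all [K]. *)
Lemma W_union_null (I : eqType) (r : seq I) (K : I -> set 'rV[R]_d) :
  {in r, forall x, null (K x)} -> W (\big[setU/set0]_(x <- r) K x) = 0.
Proof.
elim: r K => [|x r IH] K nK; first by rewrite big_nil.
have nx : null (K x) by apply: nK; rewrite mem_head.
have nr y : y \in r -> null (K y) by move=> yr; apply: nK; rewrite inE yr orbT.
rewrite W_big_cons; last by move=> y /nK/null_body.
by rewrite W_null // !IH ?subr0 ?addr0 // => y yr; apply: nullI => //; exact: nr.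
Qed.

Lemma W_union_pairwise_null (I : eqType) (r : seq I) (K : I -> set 'rV[R]_d) :
  uniq r -> {in r, forall x, convex_body (K x)} ->
  {in r &, forall x y, x != y -> null (K x `&` K y)} ->
  W (\big[setU/set0]_(x <- r) K x) = \sum_(x <- r) W (K x).
Proof.
elim: r K => [|x r IH] K; first by rewrite !big_nil.
move=> /andP[xr ur] cK nK; rewrite W_big_cons // big_cons IH //; last 2 first.
- by move=> y yr; apply: cK; rewrite inE yr orbT.
- by move=> y z yr zr; apply: nK; rewrite inE ?yr ?zr orbT.
rewrite W_union_null ?subr0 // => y yr; apply: nK; rewrite ?mem_head ?inE ?yr ?orbT //.
by apply: contraNneq xr => ->.
Qed.

(* Only single and pairwise terms survive in the inclusion-exclusion formula;
   pairs are summed over both orders, whence the factor 2. *)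
Lemma W_union_triplewise_null (I : eqType) (r : seq I) (K : I -> set 'rV[R]_d) :
  uniq r -> {in r, forall x, convex_body (K x)} ->
  {in r &, forall x y, convex_body (K x `&` K y)} ->
  {in r & r & r, forall x y z, x != y -> x != z -> y != z ->
    null (K x `&` K y `&` K z)} ->
  2 * W (\big[setU/set0]_(x <- r) K x) =
  2 * \sum_(x <- r) W (K x) - \sum_(x <- r) \sum_(y <- r | y != x) W (K x `&` K y).
Proof.
elim: r K => [|x r IH] K; first by rewrite !big_nil W0 !mulr0 subr0.
move=> /andP[xr ur] cK cK2 nK.
have xx : x \in x :: r by rewrite mem_head.
have sub y : y \in r -> y \in x :: r by rewrite inE => ->; rewrite orbT.
have nx y : y \in r -> y != x by move=> yr; apply: contraNneq xr => <-.
rewrite W_big_cons // !big_cons eqxx /=.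
(* The sets [K x] meet [K y], for fixed x, intersect each other in triple intersections, so [W] is
   additive on them. *)
rewrite (W_union_pairwise_null (r := r) (K := fun y => K x `&` K y)) //; last 2 first.
- by move=> y yr; apply: cK2 => //; exact: sub.
- move=> y z yr zr yz; rewrite setIACA setIid setIA; by apply: (nK) => //; rewrite ?sub // eq_sym nx.
have {}IH := IH K ur; rewrite mulrBr mulrDr IH //; last 3 first.
- by move=> y yr; apply/cK/sub.
- by move=> y z yr zr; apply: cK2; exact: sub.
- by move=> y z t yr zr tr; apply: nK; exact: sub.
have -> : \sum_(y <- r | y != x) W (K x `&` K y) = \sum_(y <- r) W (K x `&` K y).
  by rewrite big_seq_cond [RHS]big_seq; apply: eq_bigl => y; case: (boolP (y \in r)) => // /nx.
have -> : \sum_(y <- r) \sum_(z <- x :: r | z != y) W (K y `&` K z) =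
    \sum_(y <- r) W (K x `&` K y) + \sum_(y <- r) \sum_(z <- r | z != y) W (K y `&` K z).
  rewrite -big_split /= big_seq [RHS]big_seq; apply: eq_bigr => y yr.
  by rewrite big_cons eq_sym nx //= setIC.
by ring.
Qed.

End inclusion_exclusion.

(** * Intrinsic volume of unions of grid cubes *)

Section grid.
Context {R : realType} {d : nat}.
Variable N : nat.
Hypothesis N0 : (0 < N)%N.

(** Natural number coordinates turn intersections into [maxn] and [minn], so that [lia] settles the
    geometry. *)
Definition gbox (a b : 'I_d -> nat) : set 'rV[R]_d :=
  box (fun i => (a i)%:R / N%:R) (fun i => (b i)%:R / N%:R).

Lemma gboxI a b a' b' :
  gbox a b `&` gbox a' b' = gbox (fun i => maxn (a i) (a' i)) (fun i => minn (b i) (b' i)).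
Proof.
have N0R : 0 < N%:R :> R by rewrite ltr0n.
apply/seteqP; split=> x.
  move=> [h h'] i; have /andP[] := h i; have /andP[] := h' i.
  rewrite !ler_pdivrMr // !ler_pdivlMr // => ? ? ? ?.
  by case: (leqP (a i)) => ?; case: (leqP (b i)) => ?; apply/andP.
move=> h; split=> i; have /andP[] := h i;
  rewrite !ler_pdivrMr // !ler_pdivlMr // => h1 h2; apply/andP; split.
- by apply: le_trans h1; rewrite ler_nat leq_maxl.
- by apply: le_trans h2 _; rewrite ler_nat geq_minl.
- by apply: le_trans h1; rewrite ler_nat leq_maxr.
- by apply: le_trans h2 _; rewrite ler_nat geq_minr.
Qed.

(** Boxes that are empty, or flat in two coordinates, hence of dimension at most d-2. Inequalities
    instead of equalities make the class stable under intersection. *)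
Definition gnull (A : set 'rV[R]_d) : Prop := exists a b, A = gbox a b /\
  ((exists i, b i < a i)%N \/ exists i j, [/\ i != j, (b i <= a i)%N & (b j <= a j)%N]).

Lemma gnull_body A : gnull A -> convex_body A.
Proof. by move=> [a [b [-> _]]]; exact: box_convex_body. Qed.

Lemma gnullI A B : gnull A -> gnull B -> gnull (A `&` B).
Proof.
move=> [a [b [-> h]]] [a' [b' [-> _]]]; rewrite gboxI.
exists (fun i => maxn (a i) (a' i)), (fun i => minn (b i) (b' i)); split=> //.
case: h => [[i h]|[i [j [ij h1 h2]]]]; [left; exists i|right; exists i, j; split=> //]; lia.
Qed.

Lemma gbox_empty a b i : (b i < a i)%N -> gbox a b = set0.
Proof.
move=> ba; apply/seteqP; split=> x // /(_ i) /andP[h1 h2].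
have := le_trans h1 h2; rewrite ler_pM2r ?invr_gt0 ?ltr0n // ler_nat; lia.
Qed.

Variable V : nat -> set 'rV[R]_d -> R.
Hypothesis hV : intrinsic_volumes V.
Hypothesis d0 : (0 < d)%N.

Lemma V_gbox a b : (forall i, a i <= b i)%N ->
  V d.-1 (gbox a b) = facet_sum (fun i => (b i - a i)%:R / N%:R).
Proof.
move=> ab; rewrite intrinsic_volume_box //; last first.
  by move=> i; rewrite ler_pM2r ?invr_gt0 ?ltr0n // ler_nat.
by congr facet_sum; apply/funext => i; rewrite natrB // mulrBl.
Qed.

Lemma V_set0 : V d.-1 set0 = 0.
Proof. by case: hV => _ -> //; exact: leq_pred. Qed.

Lemma gnull_V A : gnull A -> V d.-1 A = 0.
Proof.
move=> [a [b [-> h]]].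
have [/existsP[i ba]|] := boolP [exists i, b i < a i]%N.
  by rewrite (gbox_empty ba) V_set0.
rewrite negb_exists => /forallP ab.
case: h => [[i h]|[i [j [ij h1 h2]]]]; first by have := ab i; rewrite h.
rewrite V_gbox; last by move=> k; have := ab k; rewrite -leqNgt.
rewrite /facet_sum big1 // => k _.
(* Each product of [facet_sum] omits one side only, so one of the two zero sides remains in it. *)
have [l [lk hl]] : exists l, l != k /\ (b l - a l = 0)%N.
  by have [ik|ik] := eqVneq i k; [exists j; rewrite -ik eq_sym|exists i]; split=> //; lia.
by rewrite (bigD1 l) //= hl !mul0r.
Qed.

Implicit Types z : {ffun 'I_d -> nat}.
Definition gcube z := gbox z (fun i => (z i).+1).

(** Adjacency is oriented, z' being z plus a unit vector, so that a sum over ordered pairs counts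
    each common facet once. *)
Definition adj z z' : bool :=
  [exists i, (z' i == (z i).+1) && [forall j, (j != i) ==> (z' j == z j)]].

Lemma V_gcube z : V d.-1 (gcube z) = d%:R / N%:R ^+ d.-1.
Proof.
rewrite V_gbox // /facet_sum.
rewrite (eq_bigr (fun=> N%:R ^- d.-1)); first by rewrite sumr_const card_ord mulr_natl.
move=> i _; rewrite (eq_bigr (fun=> N%:R^-1)); last first.
  by move=> j _; rewrite subSnn mul1r.
by rewrite prodr_const cardC1 card_ord exprVn.
Qed.

Lemma ffun_neq z z' : z != z' -> exists i, z i != z' i.
Proof.
move=> zz'; apply/existsP; apply: contraNT zz'; rewrite negb_exists => /forallP h.
by apply/eqP/ffunP => i; apply/eqP; have := h i; rewrite negbK.
Qed.

(** Two cubes that differ in a coordinate share at most a point there. Either this happens in two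
    coordinates, or all three cubes differ in the same one, and three distinct unit intervals of
    integers have no common point. *)
Lemma gcube_null z1 z2 z3 : z1 != z2 -> z1 != z3 -> z2 != z3 ->
  gnull (gcube z1 `&` gcube z2 `&` gcube z3).
Proof.
move=> /ffun_neq[i hi] /ffun_neq[j hj] /ffun_neq[k hk]; rewrite !gboxI.
eexists _, _; split; first by [].
have [ij|ij] := eqVneq i j; last by right; exists i, j; split=> //; lia.
have [ik|ik] := eqVneq i k; last by right; exists i, k; split=> //; lia.
by left; exists i; subst j k; lia.
Qed.

Lemma adj_neq2 z z' i j : i != j -> z i != z' i -> z j != z' j -> adj z z' = false.
Proof.
move=> ij zi zj; case E: (adj z z') => //; move: E; rewrite /adj => /existsP[k /andP[_ /forallP h]].
have ki : k = i by apply/eqP; apply: contraNT zi; have := h i; rewrite eq_sym => /implyP h' /h'; rewrite eq_sym.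
by have := h j; rewrite ki eq_sym ij /= eq_sym (negPf zj).
Qed.

Lemma adj_neq1 z z' i : (forall j, j != i -> z j = z' j) -> z i != z' i ->
  adj z z' = (z' i == (z i).+1).
Proof.
move=> h zi; rewrite /adj; apply/existsP/idP => [[k /andP[zk /forallP hk]]|zi1].
  have [<-//|ki] := eqVneq k i.
  by have := hk i; rewrite eq_sym ki /= eq_sym (negPf zi).
exists i; rewrite zi1; apply/forallP => j; apply/implyP => /h ->; exact: eqxx.
Qed.

Lemma V_gcubeI z z' : z != z' ->
  V d.-1 (gcube z `&` gcube z') = (adj z z' + adj z' z)%N%:R / N%:R ^+ d.-1.
Proof.
move=> /ffun_neq[i hi]; have hi' : z' i != z i by rewrite eq_sym.
have [/existsP[j /andP[ij hj]]|] := boolP [exists j, (i != j) && (z j != z' j)].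
  rewrite (adj_neq2 ij hi hj) (adj_neq2 ij hi') 1?eq_sym // mul0r gnull_V //.
  by rewrite gboxI; eexists _, _; split; first by []; right; exists i, j; split=> //; lia.
rewrite negb_exists => /forallP h.
have {}h j : j != i -> z j = z' j.
  by move=> ji; have := h j; rewrite eq_sym ji negbK => /eqP.
have h' j : j != i -> z' j = z j by move=> /h.
rewrite (adj_neq1 h hi) (adj_neq1 h' hi').
rewrite gboxI.
have [E|E] := boolP ((z' i == (z i).+1) || (z i == (z' i).+1)); last first.
  rewrite (@gbox_empty _ _ i); last by lia.
  by rewrite V_set0; move: E; rewrite negb_or => /andP[/negPf -> /negPf ->]; rewrite mul0r.
have -> : ((z' i == (z i).+1) + (z i == (z' i).+1) = 1)%N by lia.
rewrite V_gbox; last first.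
  by move=> j; have [->|/h ->] := eqVneq j i; lia.
(* The common facet is flat in direction i, so only the product omitting i survives. *)
rewrite /facet_sum (bigD1 i) //= [X in _ + X]big1 ?addr0 => [|j ji]; last first.
  rewrite (bigD1 i) 1?eq_sym //= (_ : (_ - _ = 0)%N) ?mul0r //; lia.
rewrite (eq_bigr (fun=> N%:R^-1)); last first.
  by move=> j /h ->; rewrite maxnn minnn subSnn mul1r.
by rewrite prodr_const cardC1 card_ord exprVn mul1r.
Qed.

Lemma V_gcubes (r : seq {ffun 'I_d -> nat}) : uniq r ->
  V d.-1 (\big[setU/set0]_(z <- r) gcube z) =
  (d%:R * (size r)%:R - \sum_(z <- r) \sum_(z' <- r) (adj z z')%:R) / N%:R ^+ d.-1.
Proof.
move=> ur; apply: (@mulfI _ 2); first by rewrite pnatr_eq0.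
case: (hV) => _ _ /(_ d.-1) hU.
rewrite (W_union_triplewise_null V_set0 _ gnull_V gnull_body gnullI) //; last 4 first.
- by move=> A B; apply: hU; exact: leq_pred.
- by move=> z _; exact: box_convex_body.
- by move=> z z' _ _; rewrite gboxI; exact: box_convex_body.
- by move=> z1 z2 z3 _ _ _; exact: gcube_null.
rewrite (eq_bigr (fun=> d%:R / N%:R ^+ d.-1)); last by move=> z _; exact: V_gcube.
rewrite big_const_seq count_predT iter_addr_0.
have -> : \sum_(z <- r) \sum_(z' <- r | z' != z) V d.-1 (gcube z `&` gcube z') =
    2 * (\sum_(z <- r) \sum_(z' <- r) (adj z z')%:R) / N%:R ^+ d.-1.
  (* Exchanging the sums identifies the two orientations, which yields the factor 2; the diagonal
     contributes nothing since no cube is adjacent to itself. *)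
  rewrite [2 * _]mulr_natl mulr2n {2}exchange_big -big_split /= mulr_suml.
  apply: eq_bigr => z _; rewrite -big_split /= mulr_suml big_mkcond.
  apply: eq_bigr => z' _; case: eqVneq => [->|zz'] /=; last by rewrite V_gcubeI 1?eq_sym // natrD.
  suff -> : adj z z = false by rewrite addr0 mul0r.
  by case E: (adj z z) => //; move: E; rewrite /adj => /existsP[i /andP[/eqP]]; lia.
by rewrite -mulr_natr; ring.
Qed.

End grid.

(** * Words as cubes of the grid *)

Section words.
Context {R : realType} {d M : nat}.
Hypothesis M0 : (0 < M)%N.
Local Notation word := (seq (letter d M)).

(* Coordinates of the cube of s in the grid of mesh M^-(size s). *)
Fixpoint corner (s : word) : {ffun 'I_d -> nat} :=
  if s is a :: s' then [ffun i => a i * M ^ size s' + corner s' i]%N else [ffun=> 0%N].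

Lemma corner_lt s i : (corner s i < M ^ size s)%N.
Proof.
elim: s => [|a s IH] /=; rewrite ffunE ?expn0 // expnS.
apply: (@leq_trans ((a i).+1 * M ^ size s)); last by rewrite leq_mul2r ltn_ord orbT.
by rewrite mulSn addnC ltn_add2r.
Qed.

(** Each coordinate of a corner is a base-M expansion: division by [M ^ size t] recovers the first
    digit, and the remainder is the corner of the tail. *)
Lemma corner_inj s t : size s = size t -> corner s = corner t -> s = t.
Proof.
elim: s t => [|a s IH] [|b t] //= [st] /ffunP E.
have h i : a i = b i :> nat /\ corner s i = corner t i.
  have := E i; rewrite !ffunE st => {}E.
  have P : (0 < M ^ size t)%N by rewrite expn_gt0 M0.
  have l1 := corner_lt s i; have l2 := corner_lt t i; rewrite st in l1.
  have E1 : (a i = b i :> nat).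
    by have := congr1 (divn^~ (M ^ size t)%N) E; rewrite !divnMDl // !divn_small // !addn0.
  by split=> //; move: E; rewrite E1 => /addnI.
rewrite (IH t) //; last by apply/ffunP => i; have [] := h i.
by congr (_ :: _); apply/ffunP => i; apply/val_inj; have [] := h i.
Qed.

Lemma cube_gcube (s : word) : cube s = gcube (M ^ size s) (corner s) :> set 'rV[R]_d.
Proof.
have M0R : 0 < M%:R :> R by rewrite ltr0n.
elim: s => [|a s IH].
  rewrite /cube /= image_id; apply/seteqP; split=> x h i; have := h i; rewrite ffunE expn0 !divr1 //.
have -> : cube (a :: s) = phi a @` cube s :> set 'rV[R]_d.
  by rewrite /cube /= -image_comp.
have Q : 0 < (M ^ size s)%:R :> R by rewrite ltr0n expn_gt0 M0.
have step (x : R) i : ((corner s i)%:R / (M ^ size s)%:R <= x <= (corner s i).+1%:R / (M ^ size s)%:R) =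
  ((corner (a :: s) i)%:R / (M ^ size (a :: s))%:R <= M%:R^-1 * (x + (a i)%:R) <=
    (corner (a :: s) i).+1%:R / (M ^ size (a :: s))%:R).
  rewrite /= ffunE expnS -addnS !natrD !natrM.
  have E (y : R) : ((a i)%:R * (M ^ size s)%:R + y) / (M%:R * (M ^ size s)%:R) =
      M%:R^-1 * (y / (M ^ size s)%:R + (a i)%:R).
    by field; rewrite !gt_eqF.
  by rewrite !E !ler_pM2l ?invr_gt0 // !lerD2r.
rewrite IH; apply/seteqP; split=> [_ [x h <-] i|y h].
  by rewrite !mxE -step; exact: h.
exists (M%:R *: y - \row_i (a i)%:R).
  by move=> i; rewrite step !mxE subrK mulKf ?gt_eqF //; exact: h.
by rewrite /phi subrK scalerA mulVf ?gt_eqF // scale1r.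
Qed.

End words.

(** The coefficients of M^(n(d-1)) V_(d-1)(F_n) as a quadratic form in the indicators X_s. The
    single terms sit on the diagonal, because X_s^2 = X_s. *)
Definition kappa {R : realType} {d M : nat} (s t : seq (letter d M)) : R :=
  d%:R * (s == t)%:R - (adj (corner s) (corner t))%:R.

Lemma V_step (R : realType) (d M : nat) (p : R) (V : nat -> set 'rV[R]_d -> R)
    (F : fractal_percolation d M p) n w :
  (0 < d)%N -> (0 < M)%N -> intrinsic_volumes V ->
  V d.-1 (step F n w) = (\sum_(s : n.-tuple (letter d M)) \sum_(t : n.-tuple (letter d M))
    kappa s t * (retained F s w && retained F t w)%:R) / (M ^ n)%:R ^+ d.-1.
Proof.
move=> d0 M0 hV.
pose r := [seq s : n.-tuple (letter d M) <- enum {: n.-tuple (letter d M)} | retained F s w].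
pose c := fun s : n.-tuple (letter d M) => corner s.
have -> : step F n w = \big[setU/set0]_(z <- map c r) gcube (M ^ n) z.
  rewrite big_map -bigcup_seq; apply/seteqP; split=> x [s /= hs].
    by rewrite cube_gcube // size_tuple => xs; exists s => //=; rewrite mem_filter hs mem_enum.
  by move: hs; rewrite mem_filter => /andP[hs _] xs; exists s => //; rewrite cube_gcube // size_tuple.
rewrite V_gcubes //; last 2 first.
- by rewrite expn_gt0 M0.
- rewrite map_inj_uniq; first exact/filter_uniq/enum_uniq.
  by move=> s t h; apply/val_inj/(corner_inj M0 _ h); rewrite !size_tuple.
congr (_ / _); rewrite big_map.
have -> : (size (map c r))%:R = \sum_(s : n.-tuple (letter d M)) (retained F s w)%:R :> R.
  rewrite size_map size_filter -sum1_count big_enum_cond /= natr_sum big_mkcond /=.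
  by apply: eq_bigr => s _; case: retained.
rewrite mulr_sumr.
under [X in _ - X]eq_bigr do rewrite big_map big_filter big_enum_cond /=.
rewrite big_filter big_enum_cond /= [X in _ - X]big_mkcond /= -sumrB; apply: eq_bigr => s _.
rewrite [in RHS](eq_bigr (fun t : n.-tuple _ => d%:R * (s == t)%:R * (retained F s w && retained F t w)%:R
   - (adj (c s) (c t))%:R * (retained F s w && retained F t w)%:R)); last first.
  by move=> t _; rewrite /kappa mulrBl.
rewrite sumrB; congr (_ - _).
  rewrite (bigD1 s) //= eqxx big1 ?addr0 ?andbb ?mulr1 // => t /negPf ts.
  by rewrite eq_sym ts mulr0 mul0r.
rewrite big_mkcond /=; case: retained => /=; last by rewrite big1 // => t _; rewrite mulr0.
by apply: eq_bigr => t _; case: retained; rewrite ?mulr1 ?mulr0.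
Qed.

(** * Words and their prefixes *)

Section prefixes.
Context {A : finType}.
Implicit Types (s t : seq A) (L : seq (seq A)).

Definition prefixes s : seq (seq A) := [seq take m s | m <- iota 1 (size s)].

Lemma prefixes_cons a s : prefixes (a :: s) = [:: a] :: map (cons a) (prefixes s).
Proof.
rewrite /prefixes /= take0 -map_comp; congr (_ :: _).
by rewrite (iotaDl 1 1) -map_comp.
Qed.

Definition all_prefixes L := flatten (map prefixes L).

(** The number of distinct Bernoulli variables that decide whether all words of L are retained. *)
Definition num_prefixes L := size (undup (all_prefixes L)).

Lemma mem_all_prefixes u L : (u \in all_prefixes L) = has (fun s => u \in prefixes s) L.
Proof. by rewrite /all_prefixes; apply/flatten_mapP/hasP. Qed.

Lemma num_prefixes_sub L L' : {subset L <= L'} -> (num_prefixes L <= num_prefixes L')%N.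
Proof.
move=> LL'; apply: uniq_leq_size; first exact: undup_uniq.
move=> u; rewrite !mem_undup !mem_all_prefixes => /hasP[s sL us].
by apply/hasP; exists s => //; exact: LL'.
Qed.

Lemma num_prefixes_eq L L' : L =i L' -> num_prefixes L = num_prefixes L'.
Proof.
by move=> LL'; apply/anti_leq; rewrite !num_prefixes_sub // => s; rewrite LL'.
Qed.

(** All the new words share the one additional prefix [[:: a]]; an empty list would not contribute
    it. *)
Lemma num_prefixes_cons a L : (0 < size L)%N ->
  num_prefixes (map (cons a) L) = (num_prefixes L).+1.
Proof.
move=> L0; rewrite /num_prefixes.
suff /perm_size -> : perm_eq (undup (all_prefixes (map (cons a) L)))
    ([:: a] :: map (cons a) (undup (all_prefixes L))) by rewrite /= size_map.
apply: uniq_perm; first exact: undup_uniq.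
  rewrite /= map_inj_uniq ?undup_uniq ?andbT; last by move=> s t [].
  apply/mapP => -[s]; rewrite mem_undup mem_all_prefixes => /hasP[t _] + [] sE.
  by rewrite -sE => /mapP[m]; rewrite mem_iota; case: t m => [|? ?] [|m].
move=> u; rewrite mem_undup inE mem_all_prefixes has_map.
apply/hasP/orP => [[s sL]|].
  rewrite /= prefixes_cons inE => /orP[->|/mapP[v vs ->]]; [by left|right].
  by rewrite map_f // mem_undup mem_all_prefixes; apply/hasP; exists s.
move=> [/eqP ->|/mapP[v]].
  case: L L0 => // s L _; exists s; first exact: mem_head.
  by rewrite /= prefixes_cons mem_head.
rewrite mem_undup mem_all_prefixes => /hasP[s sL vs] ->; exists s => //.
by rewrite /= prefixes_cons inE map_f // orbT.
Qed.

Lemma ohead_prefixes u s : u \in prefixes s -> ohead u = ohead s.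
Proof. by case: s => // a s; rewrite prefixes_cons inE => /orP[/eqP ->|/mapP[v _ ->]]. Qed.

(** A nonempty prefix keeps the first letter of its word, so the two sets of prefixes are
    disjoint. *)
Lemma num_prefixes_cat L L' :
  {in L & L', forall s t, ohead s != ohead t} ->
  num_prefixes (L ++ L') = (num_prefixes L + num_prefixes L')%N.
Proof.
move=> h; rewrite /num_prefixes -size_cat; apply/perm_size/uniq_perm.
- exact: undup_uniq.
- rewrite cat_uniq !undup_uniq andbT /=; apply/hasPn => u.
  rewrite !mem_undup !mem_all_prefixes => /hasP[t tL' /ohead_prefixes ut].
  apply/hasPn => s sL; apply/negP => /ohead_prefixes us.
  by have := h _ _ sL tL'; rewrite -us ut eqxx.
- by move=> u; rewrite mem_cat !mem_undup !mem_all_prefixes has_cat.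
Qed.

Lemma num_prefixes_seq1 s : num_prefixes [:: s] = size s.
Proof.
elim: s => [//|a s IH].
by rewrite -[[:: a :: s]]/(map (cons a) [:: s]) num_prefixes_cons // IH.
Qed.

Lemma big_tupleS (V : zmodType) n (f : seq A -> V) :
  \sum_(s : n.+1.-tuple A) f s = \sum_(a : A) \sum_(s : n.-tuple A) f (a :: s).
Proof.
rewrite pair_bigA /=.
rewrite (reindex (fun x : A * n.-tuple A => [tuple of x.1 :: x.2])) //=.
exists (fun s : n.+1.-tuple A => (thead s, [tuple of behead s])).
  by move=> [a s] _; congr (_, _); exact/val_inj.
by move=> s _; rewrite [RHS]tuple_eta; exact/val_inj.
Qed.

Lemma big_tuple0 (V : zmodType) (f : seq A -> V) :
  \sum_(s : 0.-tuple A) f s = f [::].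
Proof.
rewrite (bigD1 [tuple]) //= big1 ?addr0 // => s; by rewrite tuple0.
Qed.

End prefixes.

(** * Joint retention probabilities *)

Section retention_probability.
Context {R : realType} {A : finType} (p : R).
Hypothesis p01 : 0 < p <= 1.
Implicit Types (s t u v : seq A) (L : seq (seq A)).
Local Notation K := (#|A|%:R : R).

(* The probability that all words of L are retained, see [prob_all_retained]. *)
Definition retprob L : R := p ^+ num_prefixes L.

Let p0 : 0 <= p. Proof. by case/andP: p01 => /ltW. Qed.
Let p1 : p <= 1. Proof. by case/andP: p01. Qed.

Lemma retprob_ge0 L : 0 <= retprob L.
Proof. exact: exprn_ge0. Qed.

Lemma retprob_sub L L' : {subset L <= L'} -> retprob L' <= retprob L.
Proof. by move=> LL'; rewrite ler_wiXn2l // num_prefixes_sub. Qed.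

Lemma retprob_eq L L' : L =i L' -> retprob L = retprob L'.
Proof. by move=> LL'; rewrite /retprob (num_prefixes_eq LL'). Qed.

Lemma retprob_cons a L : (0 < size L)%N -> retprob (map (cons a) L) = p * retprob L.
Proof. by move=> L0; rewrite /retprob num_prefixes_cons // exprS. Qed.

Lemma retprob_cat L L' : {in L & L', forall s t, ohead s != ohead t} ->
  retprob (L ++ L') = retprob L * retprob L'.
Proof. by move=> h; rewrite /retprob num_prefixes_cat // exprD. Qed.

Lemma retprob1 s : retprob [:: s] = p ^+ size s.
Proof. by rewrite /retprob num_prefixes_seq1. Qed.

Lemma retprob2_neq a b s t : a != b ->
  retprob [:: a :: s; b :: t] = p ^+ (size s).+1 * p ^+ (size t).+1.
Proof.
move=> ab; rewrite -[[:: _; _]]/([:: a :: s] ++ [:: b :: t]) retprob_cat ?retprob1 //.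
by move=> ? ?; rewrite !inE => /eqP -> /eqP ->; apply: contra ab => /eqP[->].
Qed.

Lemma retprob2_eq a s t : retprob [:: a :: s; a :: t] = p * retprob [:: s; t].
Proof. by rewrite -(retprob_cons a). Qed.

Lemma retprob4_eq a s t u v :
  retprob [:: a :: s; a :: t; a :: u; a :: v] = p * retprob [:: s; t; u; v].
Proof. by rewrite -(retprob_cons a). Qed.

Lemma retprob4_neq a b s t u v : a != b ->
  retprob [:: a :: s; a :: t; b :: u; b :: v] =
  p ^+ 2 * (retprob [:: s; t] * retprob [:: u; v]).
Proof.
move=> ab; rewrite -[[:: _; _; _; _]]/([:: a :: s; a :: t] ++ [:: b :: u; b :: v]).
rewrite retprob_cat ?retprob2_eq; first by ring.
move=> ? ?; rewrite !inE => /orP[] /eqP -> /orP[] /eqP ->;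
  by apply: contra ab => /eqP[->].
Qed.

(** The first letter of u differs from a or from b, and the corresponding word is then independent
    of the other two. Adding both possibilities gives a bound that can be summed over u. *)
Lemma retprob3_le a b s t u : a != b ->
  retprob [:: a :: s; b :: t; u] <=
  p ^+ (size t).+1 * retprob [:: a :: s; u] + p ^+ (size s).+1 * retprob [:: b :: t; u].
Proof.
move=> ab; have [ub|ub] := eqVneq (ohead u) (Some b).
  rewrite -[leLHS]add0r lerD ?mulr_ge0 ?retprob_ge0 ?exprn_ge0 //.
  rewrite -[X in X * _](retprob1 (a :: s)) -retprob_cat //.
  by move=> v w; rewrite !inE => /eqP -> /orP[] /eqP ->; rewrite ?ub;
    apply: contra ab => /eqP[->].
rewrite -[leLHS]addr0 lerD ?mulr_ge0 ?retprob_ge0 ?exprn_ge0 //.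
rewrite -[X in X * _](retprob1 (b :: t)) -retprob_cat; last first.
  move=> v w; rewrite !inE => /eqP -> /orP[] /eqP -> /=; last by rewrite eq_sym.
  by apply: contra ab => /eqP[->].
by rewrite (@retprob_eq _ ([:: b :: t] ++ [:: a :: s; u])) // => v; rewrite !inE orbCA.
Qed.

(** For n <= m, the sum over all words u of length n of the probability that u and a fixed word of
    length m are retained, see [sum_retprob2]. The recursion separates the u with the same first
    letter from the (K - 1) K^n' others, which are independent of the fixed word. *)
Fixpoint pair_sum m n : R := match n, m with
  | n'.+1, m'.+1 => p * pair_sum m' n' + (K - 1) * K ^+ n' * p ^+ (m + n)
  | _, _ => p ^+ m
  end.

Lemma sum_retprob2 n s : (n <= size s)%N ->
  \sum_(u : n.-tuple A) retprob [:: s; val u] = pair_sum (size s) n.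
Proof.
elim: n s => [|n IH] s.
  move=> _; rewrite (big_tuple0 (fun u => retprob [:: s; u])).
  rewrite (_ : retprob _ = retprob [:: s]); first by rewrite retprob1; case: size.
  rewrite -[[:: s; [::]]]/([:: s] ++ [:: [::]]) /retprob.
  by rewrite (@num_prefixes_eq _ _ ([::] :: [:: s])) // => v; rewrite !inE orbC.
case: s => // a s sn; rewrite (big_tupleS _ (fun u => retprob [:: a :: s; u])).
rewrite (bigD1 a) //=; congr (_ + _).
  by rewrite -IH // mulr_sumr; apply: eq_bigr => u _; rewrite retprob2_eq.
rewrite (eq_bigr (fun=> K ^+ n * p ^+ ((size s).+1 + n.+1))); last first.
  move=> b ba; rewrite (eq_bigr (fun=> p ^+ ((size s).+1 + n.+1))); last first.
    by move=> u _; rewrite retprob2_neq 1?eq_sym // size_tuple exprD.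
  by rewrite sumr_const card_tuple -natrX mulr_natl.
have -> : K - 1 = #|A|.-1%:R by rewrite -subn1 natrB //; apply/card_gt0P; exists a.
by rewrite sumr_const cardC1 -mulrA mulr_natl.
Qed.

End retention_probability.

(** * Counting adjacent cubes *)

Section grid_count.
Context {d : nat}.
Implicit Types z : {ffun 'I_d -> nat}.

Definition shift_coord i z : {ffun 'I_d -> nat} := [ffun j => z j + (j == i)]%N.

Lemma adjE z z' : adj z z' = [exists i, z' == shift_coord i z].
Proof.
rewrite /adj; apply/eq_existsb => i; apply/andP/eqP.
  move=> [/eqP zi /forallP h]; apply/ffunP => j; rewrite ffunE.
  have [->|ji] := eqVneq j i; first by rewrite zi addn1.
  by rewrite addn0; apply/eqP/(implyP (h j)).
move=> ->; rewrite ffunE eqxx addn1 eqxx; split=> //.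
by apply/forallP => j; apply/implyP => /negPf ji; rewrite ffunE ji addn0.
Qed.

Lemma shift_inj z i j : shift_coord i z = shift_coord j z -> i = j.
Proof.
move/ffunP/(_ i); rewrite !ffunE eqxx => /addnI.
by case: eqVneq.
Qed.

Lemma adj_sum z z' : (adj z z' : nat) = (\sum_i (z' == shift_coord i z))%N.
Proof.
rewrite adjE; have [/existsP[i /eqP ->]|] := boolP [exists i, z' == shift_coord i z].
  rewrite (bigD1 i) //= eqxx big1 // => j /negPf ji.
  by case: eqP => // /shift_inj E; rewrite E eqxx in ji.
rewrite negb_exists => /forallP h; rewrite big1 // => i _.
by rewrite (negPf (h i)).
Qed.

Lemma adj_shift c z z' :
  adj [ffun i => c i + z i]%N [ffun i => c i + z' i]%N = adj z z'.
Proof.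
rewrite !adjE; apply/eq_existsb => i; apply/eqP/eqP => [/ffunP h|->].
  by apply/ffunP => j; have := h j; rewrite !ffunE -addnA => /addnI.
by apply/ffunP => j; rewrite !ffunE addnA.
Qed.

(** A cube has one successor in each of the d directions, and f takes that value at most once. *)
Lemma sum_adj_le (T : finType) (f : T -> {ffun 'I_d -> nat}) z : injective f ->
  (\sum_t adj z (f t) <= d)%N.
Proof.
move=> fI; under eq_bigr do rewrite adj_sum.
rewrite exchange_big /= -[leqRHS]card_ord -sum1_card. apply: leq_sum => i _.
have [[t ft]|nt] := pselect (exists t, f t = shift_coord i z).
  rewrite (bigD1 t) //= big1 => [|u ut]; first by case: eqP.
  by rewrite -ft (inj_eq fI) (negPf ut).
by rewrite big1 // => t _; case: eqP => // ft; case: nt; exists t.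
Qed.

Definition grid_val N (z : {ffun 'I_d -> 'I_N}) : {ffun 'I_d -> nat} := [ffun i => z i : nat].

Lemma grid_val_inj N : injective (@grid_val N).
Proof.
move=> z z' /ffunP h; apply/ffunP => i; apply/val_inj.
by have := h i; rewrite !ffunE.
Qed.

(** In direction i a successor inside the grid exists for N - 1 values of the i-th coordinate and
    all values of the others. *)
Lemma sum_adj_grid N :
  (\sum_(z : {ffun 'I_d -> 'I_N}) \sum_(z' : {ffun 'I_d -> 'I_N})
     adj (grid_val z) (grid_val z') = d * (N.-1 * N ^ d.-1))%N.
Proof.
transitivity (\sum_(z : {ffun 'I_d -> 'I_N}) \sum_(i < d) ((z i).+1 < N))%N.
  apply: eq_bigr => z _; under eq_bigr do rewrite adj_sum.
  rewrite exchange_big; apply: eq_bigr => i _ /=.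
  case: (boolP ((z i).+1 < N)%N) => h; last first.
    rewrite big1 // => z' _; case: eqP => // /ffunP/(_ i); rewrite !ffunE eqxx addn1.
    by move=> E; move: h; rewrite -E ltn_ord.
  pose u : {ffun 'I_d -> 'I_N} := [ffun j => if j == i then Ordinal h else z j].
  have uE : grid_val u = shift_coord i (grid_val z).
    apply/ffunP => j; rewrite !ffunE; case: eqP => [->|] /=; first by rewrite addn1.
    by rewrite addn0.
  rewrite (bigD1 u) //= uE eqxx big1 // => z' z'u.
  by rewrite -uE (inj_eq (@grid_val_inj N)) (negPf z'u).
rewrite exchange_big /= -[in RHS](card_ord d) -sum_nat_const; apply: eq_bigr => i _.
rewrite -big_mkcond sum1_card /=.
pose Q (j : 'I_d) : pred 'I_N := if j == i then [pred k : 'I_N | k.+1 < N]%N else predT.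
rewrite (@eq_card _ _ (family Q)); last first.
  move=> z; rewrite !inE unfold_in; apply/idP/forallP => /= [h j|/(_ i)]; last by rewrite /Q eqxx.
  by rewrite /Q; case: eqP => // ->.
rewrite card_family foldrE big_map big_enum (bigD1 i) //= /Q eqxx; congr (_ * _)%N.
  case: N Q => [|N] Q; first by apply: eq_card0 => -[].
  rewrite -sum1_card big_mkcond big_ord_recr /= inE /= ltnn addn0 (eq_bigr (fun=> 1%N)).
    by rewrite sum_nat_const card_ord muln1.
  by move=> k _; rewrite inE /= ltnS ltn_ord.
rewrite (eq_bigr (fun=> N)); first by rewrite prod_nat_const cardC1 card_ord.
by move=> j /negPf ->; rewrite card_ord.
Qed.

End grid_count.

Section word_sums.
Context {R : realType} {d M : nat}.
Hypothesis M0 : (0 < M)%N.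
Local Notation letter := (letter d M).

Lemma card_letter : #|{: letter}| = (M ^ d)%N.
Proof. by rewrite card_ffun !card_ord. Qed.

Definition corner_ord n (s : n.-tuple letter) : {ffun 'I_d -> 'I_(M ^ n)} :=
  [ffun i => Ordinal (leq_trans (corner_lt s i) (eq_leq (congr1 (expn M) (size_tuple s))))].

Lemma corner_ordE n (s : n.-tuple letter) : grid_val (corner_ord s) = corner s.
Proof. by apply/ffunP => i; rewrite !ffunE. Qed.

Lemma corner_tuple_inj n : injective (fun s : n.-tuple letter => corner s).
Proof. by move=> s t h; apply/val_inj/(corner_inj M0 _ h); rewrite !size_tuple. Qed.

Lemma corner_ord_bij n : bijective (@corner_ord n).
Proof.
apply: inj_card_bij; last by rewrite card_tuple card_letter card_ffun !card_ord -!expnM mulnC.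
by move=> s t h; apply: corner_tuple_inj; rewrite -!corner_ordE h.
Qed.

Lemma sum_adj_words n :
  \sum_(s : n.-tuple letter) \sum_(t : n.-tuple letter) (adj (corner s) (corner t))%:R =
  d%:R * (M%:R ^+ n - 1) * M%:R ^+ (n * d.-1) :> R.
Proof.
have -> : M%:R ^+ n - 1 = (M ^ n).-1%:R :> R.
  by rewrite -subn1 natrB ?expn_gt0 ?M0 // natrX.
rewrite exprM -natrX -natrX -!natrM -mulnA -sum_adj_grid natr_sum.
rewrite [RHS](reindex (@corner_ord n)); last exact/onW_bij/corner_ord_bij.
apply: eq_bigr => s _; rewrite natr_sum [RHS](reindex (@corner_ord n)); last exact/onW_bij/corner_ord_bij.
by apply: eq_bigr => t _; rewrite !corner_ordE.
Qed.

End word_sums.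

(** * Moments of the intrinsic volume *)

Section moments.
Context {R : realType} {d M : nat} (p : R).
Hypothesis d0 : (0 < d)%N.
Hypothesis M1 : (1 < M)%N.
Hypothesis p01 : 0 < p <= 1.
Local Notation letter := (letter d M).
Local Notation m := (M%:R : R).
Local Notation K := (m ^+ d).
Local Notation q := (K * p).
Local Notation prob := (retprob p).

Let M0 : (0 < M)%N. Proof. exact: ltnW. Qed.
Let p0 : 0 < p. Proof. by case/andP: p01. Qed.
Let m0 : 0 < m. Proof. by rewrite ltr0n. Qed.
Let mp : p < m. Proof. by case/andP: p01 => _ /le_lt_trans; apply; rewrite ltr1n. Qed.

Let K_card : #|{: letter}|%:R = K.
Proof. by rewrite card_letter natrX. Qed.

Let KE : K = m * m ^+ d.-1. Proof. by rewrite -exprS prednK. Qed.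

Lemma kappa_cons a (s t : seq letter) : size s = size t ->
  kappa (a :: s) (a :: t) = kappa s t :> R.
Proof. by move=> st; rewrite /kappa eqseq_cons eqxx /= st adj_shift. Qed.

Lemma kappa_cons_neq a b (s t : seq letter) : a != b ->
  kappa (a :: s) (b :: t) = - (adj (corner (a :: s)) (corner (b :: t)))%:R :> R.
Proof. by move=> ab; rewrite /kappa eqseq_cons (negPf ab) mulr0 sub0r. Qed.

(** The diagonal contributes d and the successors of s at most d, so the bound does not grow with
    n. *)
Lemma sum_kappa_le n (s : n.-tuple letter) :
  \sum_(t : n.-tuple letter) `|kappa s t : R| <= 2 * d%:R.
Proof.
apply: (@le_trans _ _ (\sum_(t : n.-tuple letter)
    (d%:R * (s == t)%:R + (adj (corner s) (corner t))%:R))).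
  apply: ler_sum => t _; apply: le_trans (ler_normB _ _) _.
  by rewrite !ger0_norm ?mulr_ge0.
rewrite big_split /= (bigD1 s) //= eqxx big1 ?addr0 ?mulr1; last first.
  by move=> t /negPf ts; rewrite eq_sym ts mulr0.
have := sum_adj_le (corner s) (@corner_tuple_inj d M M0 n).
rewrite -(ler_nat R) natr_sum => h.
by rewrite mulrDl mul1r lerD2l.
Qed.

Lemma big_tupleS2 (A : finType) n (f : seq A -> seq A -> R) :
  \sum_(s : n.+1.-tuple A) \sum_(t : n.+1.-tuple A) f s t =
  \sum_(a : A) \sum_(s : n.-tuple A) \sum_(t : n.-tuple A) f (a :: s) (a :: t) +
  \sum_(a : A) \sum_(b | b != a) \sum_(s : n.-tuple A) \sum_(t : n.-tuple A)
    f (a :: s) (b :: t).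
Proof.
rewrite (big_tupleS _ (fun s => \sum_(t : n.+1.-tuple A) f s t)) -big_split /=.
apply: eq_bigr => a _; rewrite [X in _ = _ + X]exchange_big /= -big_split /=.
by apply: eq_bigr => s _; rewrite (big_tupleS _ (f (a :: s))) (bigD1 a).
Qed.

(** The first-level cubes are separated by d (M - 1) hyperplane sections of the unit cube, each
    tiled by M^(n(d-1)) facets of level n. *)
Definition cross_count n : R := d%:R * (m - 1) * m ^+ (n * d.-1).

(** Obtained by subtraction: the pairs with a common first letter are M^d copies of the adjacent
    pairs one level lower. *)
Lemma sum_adj_cross n :
  \sum_(a : letter) \sum_(b | b != a) \sum_(s : n.-tuple letter) \sum_(t : n.-tuple letter)
    (adj (corner (a :: s)) (corner (b :: t)))%:R = cross_count n.+1.
Proof.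
have := @sum_adj_words R d M M0 n.+1.
rewrite (big_tupleS2 _ (fun s t => (adj (corner s) (corner t))%:R)).
rewrite (eq_bigr (fun=> d%:R * (m ^+ n - 1) * m ^+ (n * d.-1))); last first.
  move=> a _; rewrite -sum_adj_words //; apply: eq_bigr => s _; apply: eq_bigr => t _.
  by rewrite /= !size_tuple adj_shift.
rewrite sumr_const -[_ *+ _]mulr_natl K_card.
move/(canRL (addKr _)) => ->; rewrite /cross_count mulSn exprD KE [m ^+ n.+1]exprS.
by ring.
Qed.

(* The first two moments of M^(n(d-1)) V_(d-1)(F_n), see [expectation_V] and
   [variance_V]. *)
Definition mean_sum n : R :=
  \sum_(s : n.-tuple letter) \sum_(t : n.-tuple letter)
    kappa s t * prob [:: val s; val t].

Definition sqr_sum n : R :=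
  \sum_(s : n.-tuple letter) \sum_(t : n.-tuple letter)
  \sum_(u : n.-tuple letter) \sum_(v : n.-tuple letter)
    kappa s t * kappa u v * prob [:: val s; val t; val u; val v].

Lemma mean_sum0 : mean_sum 0 = d%:R.
Proof.
rewrite /mean_sum (big_tuple0 (fun s => \sum_(t : 0.-tuple letter) kappa s t * prob [:: s; val t])).
rewrite (big_tuple0 (fun t => kappa [::] t * prob [:: [::]; t])).
rewrite /kappa eqxx adjE.
have -> : [exists i, corner ([::] : seq letter) == @shift_coord d i (corner ([::] : seq letter))] = false.
    apply/negbTE; rewrite negb_exists; apply/forallP => i.
  by apply/eqP => /ffunP/(_ i); rewrite !ffunE eqxx.
by rewrite /retprob /num_prefixes /= expr0 subr0 !mulr1.
Qed.

Lemma mean_sumS n :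
  mean_sum n.+1 = q * mean_sum n - p ^+ (2 * n.+1) * cross_count n.+1.
Proof.
rewrite /mean_sum (big_tupleS2 _ (fun s t => kappa s t * prob [:: s; t])); congr (_ + _).
  rewrite -K_card -mulrA mulr_natl -sumr_const; apply: eq_bigr => a _.
  rewrite mulr_sumr; apply: eq_bigr => s _; rewrite mulr_sumr; apply: eq_bigr => t _.
  by rewrite retprob2_eq kappa_cons ?size_tuple // mulrCA.
rewrite -sum_adj_cross mulr_sumr -sumrN; apply: eq_bigr => a _.
rewrite mulr_sumr -sumrN; apply: eq_bigr => b ba.
rewrite mulr_sumr -sumrN; apply: eq_bigr => s _.
rewrite mulr_sumr -sumrN; apply: eq_bigr => t _.
by rewrite retprob2_neq 1?eq_sym // kappa_cons_neq 1?eq_sym // !size_tuple -exprD addnn -mul2n mulNr mulrC.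
Qed.

(** Shows that the contribution of pairs with distinct first letters has relative size (p/M)^n. *)
Lemma cross_countE n :
  p ^+ (2 * n) * cross_count n = q ^+ n * (d%:R * (m - 1) * (p / m) ^+ n).
Proof.
rewrite /cross_count [(2 * _)%N]mulnC exprM [(n * _)%N]mulnC (exprM m) KE.
rewrite !exprMn exprVn.
have : m ^+ n != 0 by rewrite expf_neq0 // gt_eqF.
by move: (m ^+ n) (p ^+ n) => x y x0; field.
Qed.

(** This form has no denominator 1 - p, so it covers p = 1 as well. *)
Lemma mean_sumE n : mean_sum n =
  q ^+ n * (d%:R * m * (1 - p) / (m - p) + d%:R * (m - 1) * p / (m - p) * (p / m) ^+ n).
Proof.
have mp0 : m - p != 0 by rewrite subr_eq0 gt_eqF.
have m0' : m != 0 by rewrite gt_eqF.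
elim: n => [|n IH]; first by rewrite mean_sum0 !expr0; field.
rewrite mean_sumS IH.
rewrite cross_countE.
by rewrite [q ^+ n.+1]exprS [(p / m) ^+ n.+1]exprS; field; rewrite mp0 m0'.
Qed.

(** In the constant 4 d, the factor 2 d comes from [sum_kappa_le] and the remaining 2 from the two
    terms of [retprob3_le]. *)
Definition cross_bound n : R :=
  4 * d%:R * p ^+ n.+1 * pair_sum p (A := letter) n.+1 n.+1 * cross_count n.+1.

Lemma cross_sum_le n :
  \sum_(a : letter) \sum_(b | b != a) \sum_(s : n.-tuple letter) \sum_(t : n.-tuple letter)
  \sum_(u : n.+1.-tuple letter) \sum_(v : n.+1.-tuple letter)
   `|kappa (a :: s) (b :: t) * kappa u v * prob [:: a :: s; b :: t; val u; val v]|
  <= cross_bound n.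
Proof.
rewrite /cross_bound -sum_adj_cross mulr_sumr; apply: ler_sum => a _.
rewrite mulr_sumr; apply: ler_sum => b ba; rewrite mulr_sumr; apply: ler_sum => s _.
rewrite mulr_sumr; apply: ler_sum => t _.
rewrite kappa_cons_neq 1?eq_sym //; set D := (adj _ _)%:R.
(* Dropping v from the list only increases the probability; the sum over v then involves [kappa]
   alone. *)
apply: (@le_trans _ _ (D * (2 * d%:R) *
    \sum_(u : n.+1.-tuple letter) prob [:: a :: s; b :: t; val u])).
  rewrite mulr_sumr; apply: ler_sum => u _.
  apply: (@le_trans _ _ (\sum_(v : n.+1.-tuple letter)
      `|kappa u v| * (D * prob [:: a :: s; b :: t; val u]))).
    apply: ler_sum => v _; rewrite !normrM normrN (ger0_norm (ler0n _ _)).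
    rewrite (ger0_norm (retprob_ge0 _ _)) // -/D mulrAC mulrC ler_wpM2l //.
    rewrite ler_wpM2l // retprob_sub // => w; rewrite !inE.
    by move=> /or3P[] ->; rewrite ?orbT.
  rewrite -mulr_suml [leRHS](_ : _ = 2 * d%:R * (D * prob [:: a :: s; b :: t; val u])); last by ring.
  by rewrite ler_wpM2r ?sum_kappa_le // mulr_ge0 // retprob_ge0.
have h (w : seq letter) : size w = n.+1 ->
    \sum_(u : n.+1.-tuple letter) prob [:: w; val u] = pair_sum p (A := letter) n.+1 n.+1.
  by move=> wn; rewrite sum_retprob2 wn.
have : \sum_(u : n.+1.-tuple letter) prob [:: a :: s; b :: t; val u] <=
    p ^+ n.+1 * pair_sum p (A := letter) n.+1 n.+1 + p ^+ n.+1 * pair_sum p (A := letter) n.+1 n.+1.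
  rewrite -{1}(h (a :: s)) ?(=^~ h (b :: t)) /= ?size_tuple //.
  rewrite !mulr_sumr -big_split /=; apply: ler_sum => u _.
  have := retprob3_le p01 s t u (a := a) (b := b).
  by rewrite !size_tuple; apply; rewrite eq_sym.
move=> /(ler_wpM2l (_ : 0 <= D * (2 * d%:R))) H.
apply: le_trans (H _) _; first by rewrite mulr_ge0.
by rewrite le_eqVlt; apply/orP; left; apply/eqP; ring.
Qed.

Lemma exchange_big2 (I J L : finType) (F : I -> J -> L -> R) :
  \sum_i \sum_j \sum_l F i j l = \sum_l \sum_i \sum_j F i j l.
Proof.
rewrite [RHS]exchange_big; apply: eq_bigr => i _.
by rewrite [RHS]exchange_big.
Qed.

Lemma exchange_big3 (I J K L : finType) (F : I -> J -> K -> L -> R) :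
  \sum_i \sum_j \sum_k \sum_l F i j k l = \sum_l \sum_i \sum_j \sum_k F i j k l.
Proof.
rewrite [RHS]exchange_big; apply: eq_bigr => i _.
exact: exchange_big2.
Qed.

Lemma ler_norm_sum_le (I : finType) (P : pred I) (F G : I -> R) :
  (forall i, P i -> `|F i| <= G i) -> `|\sum_(i | P i) F i| <= \sum_(i | P i) G i.
Proof. by move=> FG; apply: le_trans (ler_norm_sum _ _ _) (ler_sum _ _). Qed.

Lemma sqr_sumS n :
  `|sqr_sum n.+1 - (q * sqr_sum n + K * (K - 1) * p ^+ 2 * mean_sum n ^+ 2)|
  <= 2 * cross_bound n.
Proof.
pose g (s t u v : seq letter) : R := kappa s t * kappa u v * prob [:: s; t; u; v].
(* [D u v] collects the s, t with a common first letter. [R1] has such s, t but u, v with distinct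
   first letters; [R2] has s, t with distinct first letters. Outside [R1] and [R2] both pairs have a
   common first letter: if it is the same for both, this gives the term with [sqr_sum], otherwise
   independence gives the square of the mean. *)
pose D u v := \sum_(a : letter) \sum_(s : n.-tuple letter) \sum_(t : n.-tuple letter)
  g (a :: s) (a :: t) u v.
pose R1 := \sum_(c : letter) \sum_(e | e != c) \sum_(u : n.-tuple letter) \sum_(v : n.-tuple letter)
  D (c :: u) (e :: v).
pose R2 := \sum_(a : letter) \sum_(b | b != a) \sum_(s : n.-tuple letter) \sum_(t : n.-tuple letter)
  \sum_(u : n.+1.-tuple letter) \sum_(v : n.+1.-tuple letter) g (a :: s) (b :: t) u v.
have gC s t u v : g s t u v = g u v s t.
  rewrite /g [kappa s t * _]mulrC; congr (_ * _); apply: retprob_eq => w.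
  by rewrite !inE; do 4 case: (w == _).
have -> : sqr_sum n.+1 = q * sqr_sum n + K * (K - 1) * p ^+ 2 * mean_sum n ^+ 2 + (R1 + R2).
  rewrite {1}/sqr_sum (big_tupleS2 _ (fun s t => \sum_(u : n.+1.-tuple letter)
    \sum_(v : n.+1.-tuple letter) g s t u v)) -/R2 addrA; congr (_ + R2).
  rewrite exchange_big3; under eq_bigr do rewrite exchange_big3 -/(D _ _).
  rewrite (big_tupleS2 _ D) -/R1; congr (_ + R1).
  transitivity (\sum_(c : letter) (p * sqr_sum n + (K - 1) * (p ^+ 2 * mean_sum n ^+ 2))); last first.
    by rewrite sumr_const -[_ *+ _]mulr_natl K_card; ring.
  apply: eq_bigr => c _; rewrite /D exchange_big2 (bigD1 c) //=; congr (_ + _).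
    rewrite /sqr_sum mulr_sumr; apply: eq_bigr => u _; rewrite mulr_sumr; apply: eq_bigr => v _.
    rewrite mulr_sumr; apply: eq_bigr => s _; rewrite mulr_sumr; apply: eq_bigr => t _.
    by rewrite gC /g retprob4_eq !kappa_cons ?size_tuple // mulrCA.
  transitivity (\sum_(a | a != c) p ^+ 2 * mean_sum n ^+ 2); last first.
    rewrite sumr_const cardC1 -[_ *+ _]mulr_natl -K_card; congr (_ * _).
    by rewrite -subn1 natrB //; apply/card_gt0P; exists c.
  apply: eq_bigr => a ac; rewrite [mean_sum n ^+ 2]expr2 {1}/mean_sum mulr_suml mulr_sumr.
  apply: eq_bigr => u _; rewrite mulr_suml mulr_sumr; apply: eq_bigr => v _.
  rewrite /mean_sum !mulr_sumr; apply: eq_bigr => s _; rewrite !mulr_sumr; apply: eq_bigr => t _.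
  by rewrite /g retprob4_neq // !kappa_cons ?size_tuple //; ring.
rewrite addrAC subrr add0r mulr_natl; apply: le_trans (ler_normD _ _) (lerD _ _); last first.
  apply: le_trans (cross_sum_le n).
  by do 6 (apply: ler_norm_sum_le => ? _).
apply: le_trans (cross_sum_le n).
do 4 (apply: ler_norm_sum_le => ? _).
(* [R1] involves only s, t with a common first letter; adding the nonnegative terms of the other
   pairs yields the sum bounded by [cross_sum_le]. *)
rewrite (big_tupleS2 _ (fun s t => `|g _ _ s t|)) -[leLHS]addr0 lerD //; last first.
  by do 4 (apply: sumr_ge0 => ? _).
by do 3 (apply: ler_norm_sum_le => ? _); rewrite gC.
Qed.

End moments.

(** A geometric sum over the place where the two words separate; the factor in the second line tends
    to 1 + Var(W_oo). *)
Lemma pair_sumE (R : realType) (A : finType) (p : R) (n k : nat) :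
  0 < p -> 1 < #|A|%:R * p -> (n <= k)%N ->
  pair_sum p (A := A) k n = p ^+ k * (#|A|%:R * p) ^+ n *
    (1 + (1 - p) / (#|A|%:R * p - 1) * (1 - (#|A|%:R * p) ^- n)).
Proof.
move=> p0 q1; have q0 : #|A|%:R * p != 0 by rewrite gt_eqF // (lt_trans ltr01).
have A0 : #|A|%:R != 0 :> R by apply: contraNneq q0 => ->; rewrite mul0r.
have qB : #|A|%:R * p - 1 != 0 by rewrite subr_eq0 gt_eqF.
elim: n k => [|n IH] [|k] //= nk; try by rewrite !expr0 invr1 subrr mulr0 addr0 !mulr1.
rewrite IH // addSn addnS !exprS exprD.
set K := #|A|%:R in q0 A0 qB *.
have : p ^+ n != 0 by rewrite expf_neq0 // gt_eqF.
have : K ^+ n != 0 by rewrite expf_neq0.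
rewrite !exprMn; move: (K ^+ n) (p ^+ n) (p ^+ k) => x y z x0 y0.
by field; rewrite x0 y0 gt_eqF // A0 qB.
Qed.

Lemma pair_sum_le (R : realType) (A : finType) (p : R) (n : nat) :
  0 < p <= 1 -> 1 < #|A|%:R * p ->
  pair_sum p (A := A) n n <=
    p ^+ n * (#|A|%:R * p) ^+ n * (1 + (1 - p) / (#|A|%:R * p - 1)).
Proof.
move=> /andP[p0 p1] q1; have q0 : 0 < #|A|%:R * p by exact: lt_trans q1.
rewrite pair_sumE //; apply: ler_wpM2l.
  by rewrite mulr_ge0 // exprn_ge0 // ltW.
rewrite lerD2l.
have c0 : 0 <= (1 - p) / (#|A|%:R * p - 1) by rewrite divr_ge0 ?subr_ge0 // ltW.
by rewrite -[leRHS]mulr1 ler_wpM2l // gerBl invr_ge0 exprn_ge0 // ltW.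
Qed.

(** * Perturbed contractions and the variance *)

Section contraction.
Context {R : realType} (r rho C : R) (e : nat -> R).
Hypothesis r0 : 0 < r.
Hypothesis rho0 : 0 < rho.
Hypothesis C0 : 0 <= C.
Hypothesis e_rec : forall n, `|e n.+1| <= r * `|e n| + C * rho ^+ n.

Lemma contraction_lt : r < rho -> exists C', forall n, `|e n| <= C' * rho ^+ n.
Proof.
move=> rrho; have dr : 0 < rho - r by rewrite subr_gt0.
exists (`|e 0| + C / (rho - r)) => n; set C' := _ + _.
have C'0 : 0 <= C' by rewrite addr_ge0 // divr_ge0 // ltW.
have CC : C <= (rho - r) * C'.
  have -> : (rho - r) * C' = (rho - r) * `|e 0| + C by rewrite /C'; field; rewrite gt_eqF.
  by rewrite lerDr mulr_ge0 // ltW.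
elim: n => [|n IH]; first by rewrite mulr1 /C' lerDl divr_ge0 // ltW.
apply: le_trans (e_rec n) _; have h : 0 <= rho ^+ n by rewrite exprn_ge0 // ltW.
apply: le_trans (lerD (ler_wpM2l (ltW r0) IH) (ler_wpM2r h CC)) _.
by rewrite exprS le_eqVlt; apply/orP; left; apply/eqP; ring.
Qed.

Lemma contraction_eq : r = rho ->
  exists C', forall n, (0 < n)%N -> `|e n| <= C' * (rho ^+ n * n%:R).
Proof.
move=> rrho; exists (`|e 0| + C / rho).
have Cr : 0 <= C / rho by rewrite divr_ge0 // ltW.
(* In the resonant case each step adds C / rho to the coefficient of rho^n; for n >= 1 the initial
   value is absorbed into the factor n. *)
have h n : `|e n| <= (`|e 0| + C / rho * n%:R) * rho ^+ n.
  elim: n => [|n IH]; first by rewrite mulr0 addr0 mulr1.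
  apply: le_trans (e_rec n) _; apply: le_trans (lerD (ler_wpM2l (ltW r0) IH) (lexx _)) _.
  rewrite exprS -natr1 rrho le_eqVlt; apply/orP; left; apply/eqP; field; by rewrite gt_eqF.
move=> n n0; apply: le_trans (h n) _.
rewrite [rho ^+ n * _]mulrC mulrA ler_wpM2r ?exprn_ge0 ?(ltW rho0) //.
by rewrite mulrDl lerD2r ler_peMr // ler1n.
Qed.

Lemma contraction_gt : rho < r -> exists C', forall n, `|e n| <= C' * r ^+ n.
Proof.
move=> rrho; have dr : 0 < r - rho by rewrite subr_gt0.
pose G := C / (r - rho); have G0 : 0 <= G by rewrite divr_ge0 // ltW.
(* The subtracted multiple of rho^n absorbs the perturbation, since C = G (r - rho). *)
have h n : `|e n| <= (`|e 0| + G) * r ^+ n - G * rho ^+ n.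
  elim: n => [|n IH]; first by rewrite !mulr1 addrK.
  apply: le_trans (e_rec n) _; apply: le_trans (lerD (ler_wpM2l (ltW r0) IH) (lexx _)) _.
  rewrite !exprS le_eqVlt; apply/orP; left; apply/eqP; rewrite /G; field; by rewrite gt_eqF.
exists (`|e 0| + G) => n; apply: le_trans (h n) _.
by rewrite gerBl mulr_ge0 // exprn_ge0 // ltW.
Qed.

End contraction.

(** Here x is the second moment and y the mean. As K(K-1)p^2 = q^2 - qp, the variance x - y^2 is
    multiplied by q and gains q(1-p) y^2 up to lower-order terms. After division by q^(2n), the
    subtracted constant is the fixed point of v -> v/q + c1^2 (1-p)/q. *)
Lemma normalized_variance_rec (R : realType) (p q K rho c1 B beta E : R) (x y P : nat -> R) :
  1 < q -> q = K * p -> 0 <= rho <= 1 ->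
  (forall n, y n = q ^+ n * (c1 + B * rho ^+ n)) ->
  (forall n, P n = q ^+ n * (beta * rho ^+ n)) ->
  (forall n, y n.+1 = q * y n - P n.+1) ->
  (forall n, `|x n.+1 - (q * x n + K * (K - 1) * p ^+ 2 * y n ^+ 2)| <=
     E * (q ^+ (2 * n.+1) * rho ^+ n.+1)) ->
  let e n := (x n - y n ^+ 2) / q ^+ (2 * n) - c1 ^+ 2 * ((1 - p) / (q - 1)) in
  exists2 C, 0 <= C & forall n, `|e n.+1| <= q^-1 * `|e n| + C * rho ^+ n.
Proof.
move=> q1 qE /andP[rho0 rho1] yE PE yS xS e.
have q0 : 0 < q by exact: lt_trans q1.
(* The coefficients of rho^n and rho^(2n) left after the fixed point is removed. *)
pose al := (1 - p) / q * 2 * c1 * B + 2 * c1 * beta * rho.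
pose ga := (1 - p) / q * B ^+ 2 + 2 * B * beta * rho - beta ^+ 2 * rho ^+ 2.
have E0 : 0 <= E * rho.
  have := le_trans (normr_ge0 _) (xS 0); rewrite mulrA mulrAC expr1.
  by rewrite pmulr_lge0 // exprn_gt0.
exists (`|al| + `|ga| + E * rho); first by rewrite !addr_ge0.
move=> n; set t := rho ^+ n.
have t0 : 0 <= t by rewrite exprn_ge0.
have t1 : t <= 1 by rewrite exprn_ile1.
pose D := x n.+1 - (q * x n + K * (K - 1) * p ^+ 2 * y n ^+ 2).
have Qn0 : q ^+ n != 0 by rewrite expf_neq0 // gt_eqF.
have eE : e n.+1 = q^-1 * e n + (al + ga * t) * t + D / q ^+ (2 * n.+1).
  rewrite /e; have -> : x n.+1 = D + (q * x n + K * (K - 1) * p ^+ 2 * y n ^+ 2) by rewrite /D subrK.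
  rewrite yS PE yE; move: D => D'.
  rewrite ![(2 * _)%N]mulnC !exprM [q ^+ n.+1]exprS [rho ^+ n.+1]exprS -/t /al /ga.
  move: (q ^+ n) Qn0 => Q Q0; have KE : K * p = q by [].
  have -> : K * (K - 1) * p ^+ 2 = q ^+ 2 - q * p by rewrite qE; ring.
  by field; rewrite Q0 subr_eq0 !gt_eqF.
rewrite eE; apply: le_trans (ler_normD _ _) _; rewrite [leRHS](_ : _ =
  q^-1 * `|e n| + (`|al| + `|ga|) * t + E * rho * t); last by ring.
apply: lerD.
  apply: le_trans (ler_normD _ _) _; rewrite !normrM (gtr0_norm (_ : 0 < q^-1)) ?invr_gt0 //.
  rewrite (ger0_norm t0) lerD2l ler_wpM2r //; apply: le_trans (ler_normD _ _) _.
  by rewrite normrM (ger0_norm t0) lerD2l ler_piMr.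
have Q2 : 0 < q ^+ (2 * n.+1) by rewrite exprn_gt0.
rewrite normrM normfV (gtr0_norm Q2) ler_pdivrMr //; apply: le_trans (xS n) _.
by rewrite exprS -/t le_eqVlt; apply/orP; left; apply/eqP; ring.
Qed.

Section variance_asymptotics.
Context {R : realType} {d M : nat} (p : R).
Hypothesis d0 : (0 < d)%N.
Hypothesis M1 : (1 < M)%N.
Hypothesis p01 : 0 < p <= 1.
Local Notation m := (M%:R : R).
Local Notation K := (m ^+ d).
Local Notation q := (K * p).
Hypothesis q1 : 1 < q.
Let c1 : R := d%:R * m * (1 - p) / (m - p).

(** The factor (Mp)^(2n) undoes the normalization: (p/M)(Mp)^2 = M p^3 and (Mp)^2/q = p/M^(d-2). *)
Lemma variance_rateE n : (0 < n)%N ->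
  [\/ q^-1 < p / m /\ variance_rate d M p n = (p / m) ^+ n * (m * p) ^+ (2 * n),
      q^-1 = p / m /\ variance_rate d M p n = (p / m) ^+ n * n%:R * (m * p) ^+ (2 * n)
    | p / m < q^-1 /\ variance_rate d M p n = q^-1 ^+ n * (m * p) ^+ (2 * n)].
Proof.
move=> n0; case/andP: (p01) => p0 p1.
have m0 : 0 < m by rewrite ltr0n ltnW.
have D0 : 0 < m ^+ d.-1 by rewrite exprn_gt0.
have qE : q = m * (m ^+ d.-1 * p) by rewrite mulrA -exprS prednK.
have E1 : q^-1 = (1 / m ^+ d.-1) * (m * p)^-1.
  by rewrite qE; field; rewrite !gt_eqF.
have E2 : p / m = p ^+ 2 * (m * p)^-1 by field; rewrite !gt_eqF.
have cmp1 : (1 / m ^+ d.-1 < p ^+ 2) = (q^-1 < p / m).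
  by rewrite E1 E2 ltr_pM2r // invr_gt0 mulr_gt0.
have cmp2 : (p ^+ 2 == 1 / m ^+ d.-1) = (q^-1 == p / m).
  by rewrite E1 E2 eq_sym (inj_eq (mulIf _)) // invr_eq0 mulf_neq0 ?gt_eqF.
rewrite /variance_rate cmp1 cmp2.
have E3 : (m * p) ^+ (2 * n) = ((m * p) ^+ 2) ^+ n by rewrite exprM.
case: (ltgtP q^-1 (p / m)) => h; [constructor 1|constructor 3|constructor 2]; split=> //;
  rewrite E3.
- by rewrite -exprMn; congr (_ ^+ n); field; rewrite gt_eqF.
- rewrite -exprMn; congr (_ ^+ n); rewrite qE.
  case: d d0 => // k _; rewrite /=.
  have -> : m ^ (k.+1%:Z - 2) = m ^+ k / m.
    have -> : k.+1%:Z - 2 = k%:Z - 1 by rewrite -addn1 PoszD; ring.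
    by rewrite expfzDr ?gt_eqF // exprN1.
  by field; rewrite !gt_eqF ?exprn_gt0.
- by rewrite mulrAC -exprMn; congr (_ ^+ n * _); field; rewrite gt_eqF.
Qed.

Lemma variance_asymptotics : exists C, forall n, (0 < n)%N ->
  `|(sqr_sum p (d := d) (M := M) n - mean_sum p (d := d) (M := M) n ^+ 2) / ((M ^ n)%:R ^+ d.-1) ^+ 2
    - c1 ^+ 2 * ((1 - p) / (q - 1)) * (m * p) ^+ (2 * n)| <= C * variance_rate d M p n.
Proof.
case/andP: (p01) => p0 p1.
have m0 : 0 < m by rewrite ltr0n ltnW.
have K0 : 0 < K by rewrite exprn_gt0.
have rho01 : 0 <= p / m <= 1.
  apply/andP; split; first by rewrite divr_ge0 // ltW.
  by rewrite ler_pdivrMr // mul1r (le_trans p1) // ler1n ltnW.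
have KA : #|{: letter d M}|%:R = K :> R by rewrite card_letter natrX.
pose gs := 1 + (1 - p) / (q - 1).
pose x := @sqr_sum R d M p; pose y := @mean_sum R d M p.
(* 8 is the 2 of [sqr_sumS] times the 4 of [cross_bound], [gs] comes from [pair_sum_le], and d (M -
   1) from [cross_countE]. *)
have xS n : `|x n.+1 - (q * x n + K * (K - 1) * p ^+ 2 * y n ^+ 2)| <=
    8 * d%:R * gs * (d%:R * (m - 1)) * (q ^+ (2 * n.+1) * (p / m) ^+ n.+1).
  apply: le_trans (sqr_sumS d0 M1 p01 n) _.
  have := @pair_sum_le R (letter d M) p n.+1 p01; rewrite KA => /(_ q1) h.
  have C0 : 0 <= cross_count (R := R) (d := d) (M := M) n.+1.
    by rewrite !mulr_ge0 ?exprn_ge0 ?subr_ge0 ?ler1n // ltnW.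
  have := cross_countE p d0 M1 n.+1; move: C0 h; rewrite /cross_bound.
  move: (cross_count _) (pair_sum _ _ _) => C ps C0 h CE.
  have -> : 8 * d%:R * gs * (d%:R * (m - 1)) * (q ^+ (2 * n.+1) * (p / m) ^+ n.+1) =
     8 * d%:R * p ^+ n.+1 * (p ^+ n.+1 * q ^+ n.+1 * gs) * C.
    rewrite [LHS](_ : _ = 8 * d%:R * gs * q ^+ n.+1 * (q ^+ n.+1 * (d%:R * (m - 1) * (p / m) ^+ n.+1))); last first.
      by rewrite mul2n -addnn exprD; ring.
    by rewrite -CE mul2n -addnn exprD; ring.
  rewrite (_ : 2 * _ = 8 * d%:R * p ^+ n.+1 * ps * C); last by ring.
  by rewrite ler_wpM2r // ler_wpM2l // !mulr_ge0 ?exprn_ge0 // ltW.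
have [C C0 eS] := normalized_variance_rec q1 erefl rho01 (mean_sumE d0 M1 p01)
   (cross_countE p d0 M1) (mean_sumS p d0 M1) xS.
pose e n : R := (x n - y n ^+ 2) / q ^+ (2 * n) - c1 ^+ 2 * ((1 - p) / (q - 1)).
have {}eS n : `|e n.+1| <= q^-1 * `|e n| + C * (p / m) ^+ n by exact: eS.
have q0 : 0 < q by exact: lt_trans q1.
have eE n : (x n - y n ^+ 2) / ((M ^ n)%:R ^+ d.-1) ^+ 2
    - c1 ^+ 2 * ((1 - p) / (q - 1)) * (m * p) ^+ (2 * n) = e n * (m * p) ^+ (2 * n).
  rewrite /e [RHS]mulrBl; congr (_ - _).
  have -> : q ^+ (2 * n) = (((M ^ n)%:R ^+ d.-1) ^+ 2) * (m * p) ^+ (2 * n).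
    rewrite natrX -[in LHS](prednK d0) exprS ![(2 * n)%N]mulnC !exprM -!exprMn; congr (_ ^+ 2).
    by rewrite -exprM mulnC exprM -exprMn; congr (_ ^+ n); ring.
  rewrite -[RHS]mulrA; congr (_ * _); set Y := (_ * p) ^+ _; have Y0 : Y != 0.
    by rewrite expf_neq0 // mulf_neq0 ?gt_eqF.
  by rewrite [in RHS]invfM -mulrA mulVf ?mulr1.
have r0 : 0 < q^-1 by rewrite invr_gt0.
have rho0 : 0 < p / m by rewrite divr_gt0.
have mp0 n : 0 <= (m * p) ^+ (2 * n) by rewrite exprn_ge0 // mulr_ge0 // ltW.
have [h|h|h] := ltgtP q^-1 (p / m).
- have [C' HC'] := contraction_lt r0 rho0 C0 eS h.
  exists C' => n n0; rewrite eE normrM (ger0_norm (mp0 n)).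
  have [[_ ->]|[h' _]|[h' _]] := variance_rateE n0; last 2 first.
  - by move: h; rewrite h' ltxx.
  - by move: (lt_trans h h'); rewrite ltxx.
  by rewrite mulrA ler_wpM2r.
- have [C' HC'] := contraction_gt r0 rho0 C0 eS h.
  exists C' => n n0; rewrite eE normrM (ger0_norm (mp0 n)).
  have [[h' _]|[h' _]|[_ ->]] := variance_rateE n0.
  - by move: (lt_trans h h'); rewrite ltxx.
  - by move: h; rewrite h' ltxx.
  by rewrite mulrA ler_wpM2r.
- have [C' HC'] := contraction_eq r0 rho0 C0 eS h.
  exists C' => n n0; rewrite eE normrM (ger0_norm (mp0 n)).
  have [[h' _]|[_ ->]|[h' _]] := variance_rateE n0.
  - by move: h'; rewrite h ltxx.
  - by rewrite mulrA ler_wpM2r // HC'.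
  - by move: h'; rewrite h ltxx.
Qed.

End variance_asymptotics.

(** * Expectations *)

Section retained_polynomials.
Context {R : realType} {d M : nat} {p : R}.
Hypothesis p01 : 0 < p <= 1.
Variable F : fractal_percolation d M p.
Local Notation word := (seq (letter d M)).
Local Notation P := (Pr F).

Definition all_retained (L : seq word) (w : Omega F) : bool :=
  all (fun s => retained F s w) L.

Lemma all_retainedE L w :
  all_retained L w = all (fun u => Y F u w) (undup (all_prefixes L)).
Proof.
rewrite (eq_all_r (mem_undup _)); apply/allP/allP => [h u|h s sL].
  rewrite mem_all_prefixes => /hasP[s sL us]; have := h _ sL.
  by move: us => /mapP[k kI ->] /allP/(_ _ kI).
apply/allP => k kI; apply: h; rewrite mem_all_prefixes; apply/hasP.
by exists s => //; apply/mapP; exists k.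
Qed.

Lemma all_retained_bigcap L : [set w | all_retained L w] =
  \bigcap_(u in [set` undup (all_prefixes L)]) Y F u @^-1` [set true].
Proof.
apply/seteqP; split=> w /=; rewrite all_retainedE.
  by move/allP => h u /= uL; exact: h.
by move=> h; apply/allP => u uL; exact: h.
Qed.

Lemma measurable_all_retained L : measurable [set w | all_retained L w].
Proof.
rewrite all_retained_bigcap bigcap_seq.
by apply: bigsetI_measurable => u _; exact: measurable_funPTI.
Qed.

Lemma prob_all_retained L : P [set w | all_retained L w] = (retprob p L)%:E.
Proof.
have Lne u : u \in undup (all_prefixes L) -> u != [::].
  rewrite mem_undup mem_all_prefixes => /hasP[s _ /mapP[k]].
  by rewrite mem_iota => kI ->; case: s k kI => [|a s] [|k].
rewrite all_retained_bigcap (@Y_independent _ _ _ _ F _ (fun=> [set true])) ?undup_uniq //; last first.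
  by move=> u /Lne u0; split.
congr EFin; rewrite /retprob /num_prefixes big_seq (eq_bigr (fun=> p)).
  by rewrite -big_seq big_const_seq count_predT iter_mulr_1.
move=> u /Lne /(Y_bernoulli F)/(congr1 (fun mu => fine (mu [set true]))).
rewrite /distribution /pushforward => ->.
case/andP: p01 => p0 p1.
rewrite bernoulli_probE ?(ltW p0) // !diracE mem_set // memNset //.
by rewrite mule0 adde0 mule1.
Qed.

(** This class is closed under products ([retpolyM]) and contains V_(d-1)(F_n), N_n and W_n, so one
    computation gives integrability and moments for all of them. *)
Definition retpoly (I : finType) (c : I -> R) (L : I -> seq word) (w : Omega F) : R :=
  \sum_i c i * (all_retained (L i) w)%:R.

Lemma indic_all_retained L w : \1_[set w | all_retained L w] w = (all_retained L w)%:R :> R.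
Proof. by rewrite indicE; congr (_ : bool)%:R; apply/idP/idP; rewrite inE. Qed.

Lemma retpoly_integrable (I : finType) (c : I -> R) (L : I -> seq word) :
  P.-integrable setT (EFin \o retpoly c L).
Proof.
rewrite (_ : EFin \o _ = fun w => \sum_i (c i)%:E * (\1_[set w | all_retained (L i) w] w)%:E)%E.
  apply: integrable_sum => // i _; apply: integrableZl => //.
  by apply: integrable_indic => //; exact: measurable_all_retained.
apply/funext => w /=; rewrite /retpoly -sumEFin; apply: eq_bigr => i _.
by rewrite EFinM indic_all_retained.
Qed.

Lemma expectation_retpoly (I : finType) (c : I -> R) (L : I -> seq word) :
  ('E_P[retpoly c L] = (\sum_i c i * retprob p (L i))%:E)%E.
Proof.
rewrite unlock; transitivity (\int[P]_w \sum_i (c i)%:E * (\1_[set w | all_retained (L i) w] w)%:E)%E.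
  apply: eq_integral => w _; rewrite /retpoly -sumEFin; apply: eq_bigr => i _.
  by rewrite EFinM indic_all_retained.
have mL i := measurable_all_retained (L i).
rewrite integral_sum //; last first.
  by move=> i; apply: integrableZl => //; exact: integrable_indic.
rewrite -sumEFin; apply: eq_bigr => i _.
rewrite integralZl //; last exact: integrable_indic.
by rewrite integral_indic // setIT EFinM; congr (_ * _)%E; exact: prob_all_retained.
Qed.

Lemma retpolyM (I J : finType) (c : I -> R) (L : I -> seq word) (c' : J -> R) (L' : J -> seq word) w :
  retpoly c L w * retpoly c' L' w =
  retpoly (fun x : I * J => c x.1 * c' x.2) (fun x => L x.1 ++ L' x.2) w.
Proof.
rewrite /retpoly mulr_suml -(pair_bigA _ (fun i j => c i * c' j * (all_retained (L i ++ L' j) w)%:R)) /=.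
apply: eq_bigr => i _; rewrite mulr_sumr; apply: eq_bigr => j _.
by rewrite /all_retained all_cat -mulnb natrM mulrACA.
Qed.

Lemma expectation_retpolyM (I J : finType) (c : I -> R) (L : I -> seq word) (c' : J -> R) (L' : J -> seq word) :
  ('E_P[(fun w => retpoly c L w * retpoly c' L' w)%R] =
   (\sum_i \sum_j c i * c' j * retprob p (L i ++ L' j))%:E)%E.
Proof.
rewrite (_ : (fun w => _) = retpoly (fun x : I * J => c x.1 * c' x.2) (fun x => L x.1 ++ L' x.2)).
  by rewrite expectation_retpoly pair_bigA.
by apply/funext => w; exact: retpolyM.
Qed.

Lemma variance_retpoly (I : finType) (c : I -> R) (L : I -> seq word) :
  ('V_P[retpoly c L] = (\sum_i \sum_j c i * c j * retprob p (L i ++ L j)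
    - (\sum_i c i * retprob p (L i)) ^+ 2)%:E)%E.
Proof.
rewrite /variance covarianceE; last 3 first.
- by apply/Lfun1_integrable; exact: retpoly_integrable.
- by apply/Lfun1_integrable; exact: retpoly_integrable.
- apply/Lfun1_integrable.
  have := retpoly_integrable (fun x : I * I => c x.1 * c x.2) (fun x => L x.1 ++ L x.2).
  by congr (_.-integrable _ _); apply/funext => w; rewrite /= -retpolyM.
by rewrite expectation_retpolyM expectation_retpoly -EFinM -EFinB expr2.
Qed.

Lemma Ncubes_retpoly n :
  Ncubes F n = retpoly (fun=> 1) (fun s : n.-tuple (letter d M) => [:: val s]).
Proof.
apply/funext => w; rewrite /Ncubes /retpoly -sum1_card natr_sum big_mkcond /=.
by apply: eq_bigr => s _; rewrite inE /all_retained /= andbT mul1r; case: retained.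
Qed.

End retained_polynomials.

(** * The limit of the martingale *)

Section l2_limit.
Context {R : realType} {dT : measure_display} {T : measurableType dT} (P : probability T R).
Variables (X : nat -> T -> R) (W : T -> R) (v delta : R).
Hypothesis mX : forall n, measurable_fun setT (X n).
Hypothesis mW : measurable_fun setT W.
Hypothesis delta01 : 0 < delta < 1.
Hypothesis v0 : 0 <= v.
Hypothesis X0 : forall w, X 0 w = 1.
Hypothesis iX : forall n, P.-integrable setT (EFin \o X n).
Hypothesis EX : forall n, \int[P]_w X n w = 1.
Hypothesis sqrX : forall n k,
  (\int[P]_w ((X (n + k) w - X n w) ^+ 2)%:E = (v * (delta ^+ n - delta ^+ (n + k)))%:E)%E.
Hypothesis limX : {ae P, forall w, X n w @[n --> \oo] --> W w}.

Let d0 : 0 < delta. Proof. by case/andP: delta01. Qed.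
Let d1 : delta < 1. Proof. by case/andP: delta01. Qed.

Lemma le0_of_geometric (x c : R) : (forall k, x <= c * delta ^+ k) -> x <= 0.
Proof.
move=> h; rewrite -(mulr0 c).
have h1 : (fun _ : nat => x) @ \oo --> x by exact: cvg_cst.
have h2 : c * delta ^+ k @[k --> \oo] --> c * 0.
  by apply: cvgMl_tmp; apply: cvg_expr; rewrite gtr0_norm.
exact: (ler_cvg_to h1 h2 (nearW _ h)).
Qed.

Let msqr (f g : T -> R) : measurable_fun setT f -> measurable_fun setT g ->
  measurable_fun setT (fun w => ((f w - g w) ^+ 2)%:E).
Proof.
by move=> mf mg; apply/measurable_EFinP/measurable_funX/measurable_funB.
Qed.

(** Fatou's lemma for k -> oo with n fixed, applied off the negligible set where convergence may
    fail. *)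
Lemma fatou_sqr n : (\int[P]_w ((W w - X n w) ^+ 2)%:E <= (v * delta ^+ n)%:E)%E.
Proof.
case: limX => N [mN PN subN].
rewrite (ge0_negligible_integral mN) //; last 2 first.
- exact: msqr.
- by move=> w _; rewrite lee_fin sqr_ge0.
rewrite setTD.
have mCN := measurableC mN.
pose f k w := ((X (n + k) w - X n w) ^+ 2)%:E.
have cvgf w : (~` N) w -> f ^~ w @ \oo --> ((W w - X n w) ^+ 2)%:E.
  move=> Nw; have Xw : X k w @[k --> \oo] --> W w by apply: contrapT => h; apply: Nw; exact: subN.
  apply: cvg_EFin; first by apply: nearW => k.
  have Xnw : X (n + k) w @[k --> \oo] --> W w.
    exact: (cvg_comp (fun k => n + k)%N (X ^~ w) (cvg_addnl n) Xw).
  have h : X (n + k) w - X n w @[k --> \oo] --> W w - X n w.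
    by apply: cvgB => //; exact: cvg_cst.
  exact: (cvg_comp _ (fun x : R => x ^+ 2) h (@exprn_continuous R 2 _)).
rewrite (eq_integral (fun w => limn_einf (f ^~ w))); last first.
  by move=> w; rewrite inE => /cvgf /cvg_limn_einf_sup[-> _].
apply: le_trans (fatou P mCN _ _) _.
- by move=> k; apply: measurable_funTS; exact: msqr.
- by move=> k w _; rewrite lee_fin sqr_ge0.
rewrite limn_einf_lim; apply: lime_le; first exact: is_cvg_einfs.
apply: nearW => k; apply: (@le_trans _ _ (\int[P]_(w in ~` N) f k w)%E).
  by apply: ereal_inf_lbound; exists k => /=.
apply: (@le_trans _ _ (\int[P]_w f k w)%E).
  apply: ge0_subset_integral => //; first exact: msqr.
  by move=> w _; rewrite lee_fin sqr_ge0.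
by rewrite sqrX lee_fin ler_wpM2l // gerBl exprn_ge0 // ltW.
Qed.

Let iW2 n : P.-integrable setT (EFin \o (fun w => (W w - X n w) ^+ 2)).
Proof.
apply/integrableP; split; first exact: msqr.
under eq_integral do rewrite gee0_abs ?lee_fin ?sqr_ge0 //.
exact: le_lt_trans (fatou_sqr n) (ltry _).
Qed.

Let W2_le n : \int[P]_w ((W w - X n w) ^+ 2) <= v * delta ^+ n.
Proof.
rewrite -lee_fin /Rintegral fineK; first exact: fatou_sqr.
exact: integrable_fin_num (iW2 n).
Qed.

Let icst (c : R) : P.-integrable setT (EFin \o (fun=> c)).
Proof. exact: finite_measure_integrable_cst. Qed.

Let iD n : P.-integrable setT (EFin \o (fun w => W w - X n w)).
Proof.
(* Integrability of x follows from that of its square by |x| <= 1 + x^2. *)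
have i1 : P.-integrable setT (EFin \o (fun w => 1 + (W w - X n w) ^+ 2)).
  have := integrableD measurableT (icst 1) (iW2 n).
  by apply: eq_integrable => // w _ /=.
apply: le_integrable i1 => //; first exact/measurable_EFinP/measurable_funB.
move=> w _ /=; rewrite lee_fin [leRHS]ger0_norm; last by rewrite addr_ge0 ?sqr_ge0.
rewrite -[(_ - _) ^+ 2]real_normK ?num_real //; move: `|_| => y.
by have := sqr_ge0 (y - 1); rewrite sqrrB1; have := sqr_ge0 y; lra.
Qed.

Let iW : P.-integrable setT (EFin \o W).
Proof.
have := integrableD measurableT (iD 0) (iX 0).
by apply: eq_integrable => // w _ /=; rewrite -EFinD subrK.
Qed.

Let icomb (f g : T -> R) (a b : R) : P.-integrable setT (EFin \o f) ->
  P.-integrable setT (EFin \o g) -> P.-integrable setT (EFin \o (fun w => a * f w + b * g w)).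
Proof.
move=> jf jg; have := integrableD measurableT (integrableZl measurableT a jf) (integrableZl measurableT b jg).
by apply: eq_integrable => // w _ /=.
Qed.

Let Icomb (f g : T -> R) (a b : R) : P.-integrable setT (EFin \o f) ->
  P.-integrable setT (EFin \o g) ->
  \int[P]_w (a * f w + b * g w) = a * \int[P]_w f w + b * \int[P]_w g w.
Proof.
move=> jf jg; rewrite RintegralD //; first by rewrite !RintegralZl.
- by have := integrableZl measurableT a jf; apply: eq_integrable.
- by have := integrableZl measurableT b jg; apply: eq_integrable.
Qed.

Let I1 : \int[P]_w (1 : R) = 1.
Proof. by rewrite Rintegral_cst // mul1r; exact: (congr1 fine (probability_setT P)). Qed.

(** In place of the Cauchy-Schwarz inequality, |x| <= t + x^2/t with t = delta^k. At index 2k the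
    expectation of x^2/t is at most v delta^k, so both terms vanish in the limit. *)
Let EW : \int[P]_w W w = 1.
Proof.
apply/eqP; rewrite -subr_eq0 -normr_eq0 eq_le normr_ge0 andbT.
apply: (@le0_of_geometric _ (1 + v)) => k.
have k0 : 0 < delta ^+ k by rewrite exprn_gt0.
rewrite -{1}(EX (2 * k)) -RintegralB //.
apply: le_trans (le_normr_Rintegral _ (iD _)) _ => //.
apply: (@le_trans _ _ (\int[P]_w (delta ^+ k * 1 + delta ^- k * (W w - X (2 * k) w) ^+ 2))).
  apply: le_Rintegral => //.
  - by apply: integrable_norm.
  - exact: icomb.
  move=> w _; set x := _ - _; rewrite -[x ^+ 2]real_normK ?num_real //.
  rewrite -subr_ge0 [X in 0 <= X](_ : _ = ((2 * `|x| - delta ^+ k) ^+ 2 + 3 * delta ^+ k ^+ 2) / (4 * delta ^+ k)).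
    apply: divr_ge0; last by rewrite mulr_ge0 // ltW.
    by rewrite addr_ge0 ?sqr_ge0 // mulr_ge0 ?sqr_ge0.
  by rewrite mulr1; field; rewrite gt_eqF.
rewrite Icomb // I1 mulr1 mulrDl mul1r lerD2l.
rewrite ler_pdivrMl //; apply: le_trans (W2_le _) _.
by rewrite mulnC exprM expr2 mulrCA.
Qed.

Lemma l2_limit_variance : ('V_P[W] = v%:E)%E.
Proof.
pose a := \int[P]_w (W w - X 0 w) ^+ 2.
have av : a <= v by have := W2_le 0; rewrite mulr1.
have a0 : 0 <= a by apply: Rintegral_ge0 => w _; exact: sqr_ge0.
(* Compares the limit with X_(2k) by (x - y)^2 <= (1 + t) x^2 + (1 + 1/t) y^2, t = delta^k. The
   excess is at most t a + 2 t^2 v + t v <= (a + 3 v) t. *)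
have va : v <= a.
  rewrite -subr_le0; apply: (@le0_of_geometric _ (a + 3 * v)) => k.
  have k0 : 0 < delta ^+ k by rewrite exprn_gt0.
  have k1 : delta ^+ k <= 1 by rewrite exprn_ile1 // ltW.
  have := sqrX 0 (2 * k); rewrite add0n expr0 => E.
  have {}E : \int[P]_w ((X (2 * k) w - X 0 w) ^+ 2) = v * (1 - delta ^+ (2 * k)).
    by rewrite /Rintegral E.
  have : \int[P]_w ((X (2 * k) w - X 0 w) ^+ 2) <=
     \int[P]_w ((1 + delta ^+ k) * (W w - X 0 w) ^+ 2 + (1 + delta ^- k) * (W w - X (2 * k) w) ^+ 2).
    apply: le_Rintegral => //.
    - apply/integrableP; split; first exact: msqr.
      under eq_integral do rewrite gee0_abs ?lee_fin ?sqr_ge0 //.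
      by have := sqrX 0 (2 * k); rewrite add0n => ->; rewrite ltry.
    - exact: icomb.
    move=> w _; set x := W w - X 0 w; set y := W w - X (2 * k) w.
    have -> : X (2 * k) w - X 0 w = x - y by rewrite /x /y; ring.
    rewrite -subr_ge0 [X in 0 <= X](_ : _ = (delta ^+ k * x + y) ^+ 2 / delta ^+ k).
      by rewrite divr_ge0 ?sqr_ge0 // ltW.
    by field; rewrite gt_eqF.
  rewrite E Icomb // -/a => h.
  have := W2_le (2 * k); move: h; set b := \int[P]_w _; rewrite mulnC exprM.
  move: (delta ^+ k) k0 k1 => t t0 t1 h hb.
  have : (1 + t^-1) * b <= (1 + t^-1) * (v * t ^+ 2).
    by rewrite ler_wpM2l // addr_ge0 // invr_ge0 ltW.
  have -> : (1 + t^-1) * (v * t ^+ 2) = v * t ^+ 2 + v * t by field; rewrite gt_eqF.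
  move=> h2; have : v * t ^+ 2 <= v * t by rewrite ler_wpM2l // expr2 ler_piMr // ltW.
  lra.
have aE : a = v by apply/le_anti/andP.
have EWE : ('E_P[W] = 1%:E)%E.
  by rewrite unlock -EW /Rintegral fineK //; exact: integrable_fin_num iW.
rewrite /variance unlock EWE /= unlock -aE /a /Rintegral fineK; last first.
  exact: integrable_fin_num (iW2 0).
by apply: eq_integral => w _; rewrite X0 expr2.
Qed.

End l2_limit.

(** * Moments of the percolation and of its martingale limit *)

Section percolation_moments.
Context {R : realType} {d M : nat} {p : R}.
Hypothesis d0 : (0 < d)%N.
Hypothesis M1 : (1 < M)%N.
Hypothesis p01 : 0 < p <= 1.
Variable F : fractal_percolation d M p.
Local Notation P := (Pr F).
Local Notation m := (M%:R : R).
Local Notation q := (m ^+ d * p).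
Local Notation tup n := (n.-tuple (letter d M)).

Let p0 : 0 < p. Proof. by case/andP: p01. Qed.
Let m0 : 0 < m. Proof. by rewrite ltr0n ltnW. Qed.
Let q0 : 0 < q. Proof. by rewrite mulr_gt0 // exprn_gt0. Qed.
Let K_card : #|{: letter d M}|%:R = m ^+ d. Proof. by rewrite card_letter natrX. Qed.

Section intrinsic_volume.
Variable V : nat -> set 'rV[R]_d -> R.
Hypothesis hV : intrinsic_volumes V.

Lemma V_step_retpoly n : V d.-1 \o step F n =
  retpoly (fun st : tup n * tup n => kappa st.1 st.2 / (M ^ n)%:R ^+ d.-1)
          (fun st => [:: val st.1; val st.2]).
Proof.
apply/funext => w /=; rewrite V_step // ?(ltnW M1) // mulr_suml /retpoly.
rewrite -(pair_bigA _ (fun s t : tup n => kappa s t / (M ^ n)%:R ^+ d.-1 *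
  (all_retained [:: val s; val t] w)%:R)) /=.
apply: eq_bigr => s _; rewrite mulr_suml; apply: eq_bigr => t _.
by rewrite /all_retained /= andbT mulrAC.
Qed.

Lemma expectation_V n :
  ('E_P[V d.-1 \o step F n] = (mean_sum p (d := d) (M := M) n / (M ^ n)%:R ^+ d.-1)%:E)%E.
Proof.
rewrite V_step_retpoly expectation_retpoly //; congr EFin.
rewrite /mean_sum mulr_suml -(pair_bigA _ (fun s t : tup n => kappa s t / (M ^ n)%:R ^+ d.-1 *
  retprob p [:: val s; val t])) /=.
apply: eq_bigr => s _; rewrite mulr_suml; apply: eq_bigr => t _.
by rewrite mulrAC.
Qed.

Lemma variance_V n :
  ('V_P[V d.-1 \o step F n] = ((sqr_sum p (d := d) (M := M) n - mean_sum p (d := d) (M := M) n ^+ 2)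
     / ((M ^ n)%:R ^+ d.-1) ^+ 2)%:E)%E.
Proof.
have E := expectation_V n; rewrite V_step_retpoly expectation_retpoly // in E.
case: E => E; rewrite V_step_retpoly variance_retpoly // E; congr EFin.
rewrite mulrBl -expr_div_n; congr (_ - _).
rewrite /sqr_sum mulr_suml -(pair_bigA _ (fun s t : tup n => \sum_(uv : tup n * tup n)
   kappa s t / (M ^ n)%:R ^+ d.-1 * (kappa uv.1 uv.2 / (M ^ n)%:R ^+ d.-1) *
   retprob p ([:: val s; val t] ++ [:: val uv.1; val uv.2]))) /=.
apply: eq_bigr => s _; rewrite mulr_suml; apply: eq_bigr => t _.
rewrite mulr_suml -(pair_bigA _ (fun u v : tup n =>
   kappa s t / (M ^ n)%:R ^+ d.-1 * (kappa u v / (M ^ n)%:R ^+ d.-1) *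
   retprob p [:: val s; val t; val u; val v])) /=.
apply: eq_bigr => u _; rewrite mulr_suml; apply: eq_bigr => v _.
by rewrite /= expr2 invfM; ring.
Qed.

Let c1 : R := d%:R * m * (1 - p) / (m - p).
Let B : R := d%:R * (m - 1) * p / (m - p).

Lemma expectation_VE n : ('E_P[V d.-1 \o step F n] =
  ((m * p) ^+ n * (c1 + B * (p / m) ^+ n))%:E)%E.
Proof.
rewrite expectation_V mean_sumE // mulrAC; congr (_ * _)%:E.
have -> : (M ^ n)%:R ^+ d.-1 = (m ^+ d.-1) ^+ n by rewrite natrX -!exprM mulnC.
rewrite -exprVn. rewrite -exprMn; congr (_ ^+ n).
by rewrite -{1}(prednK d0) exprS; field; rewrite expf_neq0 // gt_eqF.
Qed.

Lemma rescaled_meanE n : rescaled_mean F (V d.-1) n = c1 + B * (p / m) ^+ n.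
Proof.
rewrite /rescaled_mean expectation_VE /= mulrA.
(* M^D = M^d p, so the rescaling exponent amounts to (Mp)^(-n). *)
suff -> : m `^ (n%:R * (d%:R - 1 - @Ddim R d M p)) = (m * p) ^- n.
  by rewrite mulVf ?mul1r // expf_neq0 // mulf_neq0 // gt_eqF.
have lnm : 0 < ln m by rewrite ln_gt0 // ltr1n.
rewrite /powR gt_eqF // -mulrA.
have -> : (d%:R - 1 - @Ddim R d M p) * ln m = - ln (m * p).
  rewrite /Ddim !lnM ?posrE ?exprn_gt0 // lnXn // -[_ *+ d]mulr_natl.
  by field; rewrite gt_eqF.
by rewrite mulrN expRN expRM_natl lnK // posrE mulr_gt0.
Qed.

Lemma cvg_rescaled_mean : rescaled_mean F (V d.-1) n @[n --> \oo] --> c1.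
Proof.
have -> : rescaled_mean F (V d.-1) = (fun n => c1 + B * (p / m) ^+ n).
  by apply/funext => n; exact: rescaled_meanE.
suff : c1 + B * (p / m) ^+ n @[n --> \oo] --> c1 + B * 0 by rewrite mulr0 addr0.
apply: cvgD; first exact: cvg_cst.
apply: cvgMl_tmp; apply: cvg_expr.
rewrite ger0_norm ?divr_ge0 ?ltW // ltr_pdivrMr // mul1r.
by case/andP: p01 => _ /le_lt_trans; apply; rewrite ltr1n.
Qed.

Lemma VbarE : Vbar F (V d.-1) = c1.
Proof. exact: cvg_lim cvg_rescaled_mean. Qed.

End intrinsic_volume.

Section offspring.
Hypothesis q1 : 1 < q.

Lemma expectation_Ncubes n : ('E_P[Ncubes F n] = (q ^+ n)%:E)%E.
Proof.
rewrite Ncubes_retpoly expectation_retpoly //; congr EFin.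
rewrite (eq_bigr (fun=> p ^+ n)); last by move=> s _; rewrite mul1r retprob1 size_tuple.
by rewrite sumr_const card_tuple -[_ *+ _]mulr_natl natrX K_card exprMn.
Qed.

Lemma Wn_retpoly n : Wn F n = retpoly (fun=> q ^- n) (fun s : tup n => [:: val s]).
Proof.
apply/funext => w; rewrite /Wn expectation_Ncubes /= Ncubes_retpoly mulrC /retpoly mulr_sumr.
by apply: eq_bigr => s _; rewrite mul1r.
Qed.

(** Divided by q^k q^n this is the mean of W_k W_n, and it depends only on the smaller index n: the
    orthogonality of martingale increments. *)
Lemma sum_retprob_tuples k n : (n <= k)%N ->
  \sum_(s : tup k) \sum_(t : tup n) retprob p [:: val s; val t] =
  q ^+ k * q ^+ n * (1 + (1 - p) / (q - 1) * (1 - q ^- n)).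
Proof.
move=> nk; rewrite (eq_bigr (fun=> pair_sum p (A := letter d M) k n)); last first.
  by move=> s _; rewrite sum_retprob2 size_tuple.
rewrite sumr_const card_tuple -[_ *+ _]mulr_natl natrX K_card pair_sumE ?K_card //.
by rewrite mulrA mulrA -exprMn.
Qed.

Lemma sqr_dist_Wn n k : (\int[P]_w ((Wn F (n + k) w - Wn F n w) ^+ 2)%:E =
  ((1 - p) / (q - 1) * (q^-1 ^+ n - q^-1 ^+ (n + k)))%:E)%E.
Proof.
(* The difference is one [retpoly] over the disjoint sum of the two sets of words, the shorter words
   having negative coefficients. *)
pose c (x : tup (n + k) + tup n) : R := if x is inl _ then q ^- (n + k) else - q ^- n.
pose L (x : tup (n + k) + tup n) := match x with inl s => [:: val s] | inr s => [:: val s] end.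
have -> : (\int[P]_w ((Wn F (n + k) w - Wn F n w) ^+ 2)%:E =
   'E_P[(fun w => retpoly c L w * retpoly c L w)%R])%E.
  rewrite unlock; apply: eq_integral => w _; rewrite -expr2; congr ((_ ^+ 2)%:E).
  rewrite !Wn_retpoly /retpoly big_sumType /= -sumrN; congr (_ + _).
  by apply: eq_bigr => s _; rewrite mulNr.
rewrite expectation_retpolyM //; congr EFin; rewrite big_sumType /=.
have E1 : \sum_(s : tup (n + k)) \sum_j q ^- (n + k) * c j * retprob p ([:: val s] ++ L j) =
    q ^- (n + k) * q ^- (n + k) * \sum_(s : tup (n + k)) \sum_(t : tup (n + k)) retprob p [:: val s; val t]
  - q ^- (n + k) * q ^- n * \sum_(s : tup (n + k)) \sum_(t : tup n) retprob p [:: val s; val t].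
  rewrite !mulr_sumr -sumrB; apply: eq_bigr => s _; rewrite big_sumType /= !mulr_sumr -sumrN.
  by congr (_ + _); apply: eq_bigr => t _; rewrite mulrN mulNr.
have E2 : \sum_(s : tup n) \sum_j - q ^- n * c j * retprob p ([:: val s] ++ L j) =
  - (q ^- (n + k) * q ^- n * \sum_(s : tup (n + k)) \sum_(t : tup n) retprob p [:: val s; val t])
  + q ^- n * q ^- n * \sum_(s : tup n) \sum_(t : tup n) retprob p [:: val s; val t].
  rewrite [X in - (_ * X)]exchange_big !mulr_sumr -sumrN -big_split /=.
  apply: eq_bigr => s _; rewrite big_sumType /= !mulr_sumr -sumrN.
  congr (_ + _); apply: eq_bigr => t _; last by rewrite mulrNN.
  rewrite mulNr mulNr [q ^- n * _]mulrC; congr (- (_ * _)); apply: retprob_eq => u.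
  by rewrite !inE orbC.
rewrite E1 E2 !sum_retprob_tuples ?leq_addr // !exprVn.
have : q ^+ n != 0 by rewrite expf_neq0 // gt_eqF.
have : q ^+ (n + k) != 0 by rewrite expf_neq0 // gt_eqF.
have : q - 1 != 0 by rewrite subr_eq0 gt_eqF.
move: (q ^+ (n + k)) (q ^+ n) (q - 1) => x y z z0 x0 y0.
by field; rewrite x0 y0 z0.
Qed.

Lemma variance_Winfty (W : {RV P >-> R}) : is_Winfty F W ->
  ('V_P[W] = ((1 - p) / (q - 1))%:E)%E.
Proof.
have iWn n : P.-integrable setT (EFin \o Wn F n).
  by rewrite Wn_retpoly; exact: retpoly_integrable.
apply: (@l2_limit_variance _ _ _ P (Wn F) W _ q^-1).
- by move=> n; have /integrableP[/measurable_EFinP] := iWn n.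
- by [].
- by rewrite invr_gt0 q0 invf_lt1.
- by case/andP: p01 => _ p1; rewrite divr_ge0 ?subr_ge0 // ltW.
- move=> w; rewrite Wn_retpoly /retpoly expr0 invr1.
  rewrite (big_tuple0 (fun s => 1 * (all_retained [:: s] w)%:R)) mul1r /=.
  by rewrite /all_retained.
- exact: iWn.
- move=> n; rewrite /Rintegral; have := expectation_retpoly p01 F (fun=> q ^- n) (fun s : tup n => [:: val s]).
  rewrite -Wn_retpoly unlock => -> /=.
  rewrite (eq_bigr (fun=> q ^- n * p ^+ n)); last by move=> s _; rewrite retprob1 size_tuple.
  rewrite sumr_const card_tuple -[_ *+ _]mulr_natl natrX K_card mulrCA -exprMn.
  by rewrite mulVf // expf_neq0 // gt_eqF.
- exact: sqr_dist_Wn.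
Qed.

End offspring.
End percolation_moments.

Theorem theorem3p2 (R : realType) (d M : nat) (p : R)
    (hd : (1 <= d)%N) (hM : (2 <= M)%N) (hp : 0 < p <= 1)
    (V : nat -> set 'rV[R]_d -> R) (hV : intrinsic_volumes V) :
  let m : R := M%:R in
  let c1 := d%:R * m * (1 - p) / (m - p) in
  let c2 := c1 ^+ 2 * ((1 - p) / (m ^+ d * p - 1)) in
  (forall F : fractal_percolation d M p,
     [/\ p != 1 -> forall n : nat,
           ('E_(Pr F)[V d.-1 \o step F n] =
             (c1 * (m * p) ^+ n
                * (1 + (m - 1) / (1 - p) * (p / m) ^+ n.+1))%:E)%E,
         p = 1 -> forall n : nat,
           ('E_(Pr F)[V d.-1 \o step F n] =
             ((m * p) ^+ n
                * (c1 + d%:R * m * (m - 1) / (m - p) * (p / m) ^+ n.+1))%:E)%E,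
         cvg (rescaled_mean F (V d.-1) n @[n --> \oo])
       & c1 = Vbar F (V d.-1)])
  /\
  (m ^- d < p ->
     (exists (C : R) (n0 : nat), forall (F : fractal_percolation d M p) (n : nat),
        (n0 <= n)%N ->
        exists2 err : R,
          ('V_(Pr F)[V d.-1 \o step F n] = (c2 * (m * p) ^+ (2 * n) + err)%:E)%E
          & `|err| <= C * variance_rate d M p n)
     /\
     (forall (F : fractal_percolation d M p) (W : {RV (Pr F) >-> R}),
        is_Winfty F W ->
        (c2%:E = (Vbar F (V d.-1) ^+ 2)%:E * 'V_(Pr F)[W])%E)).
Proof.
move=> m c1 c2; case/andP: (hp) => p0 p1.
have m0 : 0 < m by rewrite ltr0n ltnW.
have mp : m - p != 0 by rewrite subr_eq0 gt_eqF // (le_lt_trans p1) // ltr1n.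
split.
  move=> F; split.
  - move=> pn1 n; rewrite expectation_VE // -/m; congr EFin.
    have p1' : 1 - p != 0 by rewrite subr_eq0 eq_sym.
    by rewrite [(p / m) ^+ n.+1]exprS /c1; field; rewrite mp p1' gt_eqF.
  - move=> _ n; rewrite expectation_VE // -/m; congr EFin.
    by rewrite [(p / m) ^+ n.+1]exprS /c1; field; rewrite mp gt_eqF.
  - by apply/cvg_ex; exists c1; exact: cvg_rescaled_mean.
  - by rewrite VbarE.
move=> mdp; have q1 : 1 < m ^+ d * p by rewrite -ltr_pdivrMl ?exprn_gt0 // mulr1.
split; last first.
  by move=> F W hW; rewrite VbarE // variance_Winfty // -EFinM.
have [C HC] := variance_asymptotics hd hM hp q1.
(* C is chosen before F, as the moments depend on d, M and p only. The error is defined as the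
   variance minus the main term. *)
exists C, 1%N => F n n0; eexists; last exact: HC n n0.
by rewrite variance_V //; congr EFin; rewrite [RHS]addrC subrK.
Qed.
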